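(* Let $k,\ell\ge 1$ be integers, let $n=k+\ell+1$, and let $f_1,f_2:\mathbb{R}\to\mathbb{R}$ be smooth $T$-periodic functions (for some $T>0$) with $f_2>0$ and $f_1^2+f_2^2<1$. Put $f=\sqrt{1-f_1^2-f_2^2}>0$, and suppose that $$\phi:\mathbb{S}^k\times\mathbb{S}^\ell\times\mathbb{S}^1\to\mathbb{S}^{n+1}\subset\mathbb{R}^{k+1}\times\mathbb{R}^{\ell+1}\times\mathbb{R},\qquad \phi(y,z,t)=\bigl(f(t)\,y,\;f_2(t)\,z,\;f_1(t)\bigr),$$ where $\mathbb{S}^1=\mathbb{R}/T\mathbb{Z}$, is a minimal immersion. Then $-(k+\ell+1)$ is an eigenvalue of the stability operator $J$ of this immersion, with multiplicity at least $$(k+\ell+3)+(k+1)(\ell+1).$$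
   Context: $\mathbb{S}^m$ is the unit sphere in $\mathbb{R}^{m+1}$ with its round metric. An immersed hypersurface of $\mathbb{S}^{n+1}$ is minimal if its mean curvature vanishes identically. The stability operator of a compact minimal immersed hypersurface $M^n$ of $\mathbb{S}^{n+1}$ acts on smooth functions $u$ on $M$ by $J(u)=-\Delta u-nu-|A|^2u$, where $\Delta$ is the Laplace–Beltrami operator of the metric induced on $M$ by the immersion (the trace of the Hessian, so that $-\Delta$ is nonnegative), and $|A|^2=\kappa_1^2+\dots+\kappa_n^2$, with $\kappa_1,\dots,\kappa_n$ the principal curvatures of $M$ in $\mathbb{S}^{n+1}$. A real number $\lambda$ is an eigenvalue of $J$ if $J(u)=\lambda u$ for some nonzero smooth function $u$ on $M$, and its multiplicity is the dimension of the space of such $u$ (together with $0$). Here $M=\mathbb{S}^k\times\mathbb{S}^\ell\times\mathbb{S}^1$ with the immersion $\phi$. *)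

(* Defs.v *)
From HB Require Import structures.
From mathcomp Require Import all_boot all_order all_algebra.
From mathcomp Require Import all_classical all_reals all_analysis.
From mathcomp Require Import ring lra.

Set Implicit Arguments.
Unset Strict Implicit.
Unset Printing Implicit Defensive.

Import Order.TTheory GRing.Theory Num.Theory.
Import numFieldNormedType.Exports.

Local Open Scope classical_set_scope.
Local Open Scope quotient_scope.
Local Open Scope ring_scope.

(* MathComp-Analysis equips 'rV_N with the sup norm; all lengths and angles
   below refer to this Euclidean scalar product instead. *)
Definition dotv (R : realType) (N : nat) (u v : 'rV[R]_N) : R :=
  \sum_i u 0 i * v 0 i.

Definition smooth1 (R : realType) (g : R -> R) : Prop :=
  forall (m : nat) (t : R), derivable (derive1n m g) t 1.

Section LocalGeometry.
Context {R : realType} {n N : nat}.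

Definition partial {V : normedModType R} (i : 'I_n) (F : 'rV[R]_n -> V) :
    'rV[R]_n -> V :=
  fun x => 'D_(delta_mx 0 i) F x.

(* C^oo: every iterated partial derivative is differentiable everywhere. *)
Definition smooth (F : 'rV[R]_n -> R) : Prop :=
  forall (s : seq 'I_n) (x : 'rV[R]_n), differentiable (foldr partial F s) x.

Definition jac (X : 'rV[R]_n -> 'rV[R]_N) (x : 'rV[R]_n) : 'M[R]_(n, N) :=
  \matrix_(i < n) partial i X x.

(* First fundamental form. *)
Definition metric (X : 'rV[R]_n -> 'rV[R]_N) (x : 'rV[R]_n) : 'M[R]_n :=
  \matrix_(i < n, j < n) dotv (partial i X x) (partial j X x).

(* christoffel X x m i j is Gamma^m_ij, for the Levi-Civita connection of
   metric X. *)
Definition christoffel (X : 'rV[R]_n -> 'rV[R]_N) (x : 'rV[R]_n)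
    (m i j : 'I_n) : R :=
  2^-1 * \sum_(l < n) invmx (metric X x) m l *
    (partial i (fun x' => metric X x' j l) x
     + partial j (fun x' => metric X x' i l) x
     - partial l (fun x' => metric X x' i j) x).

Definition hessian (X : 'rV[R]_n -> 'rV[R]_N) (u : 'rV[R]_n -> R)
    (x : 'rV[R]_n) : 'M[R]_n :=
  \matrix_(i < n, j < n)
    (partial i (partial j u) x
     - \sum_(m < n) christoffel X x m i j * partial m u x).

(* Laplace-Beltrami operator of metric X. *)
Definition laplacian (X : 'rV[R]_n -> 'rV[R]_N) (u : 'rV[R]_n -> R)
    (x : 'rV[R]_n) : R :=
  \tr (invmx (metric X x) *m hessian X u x).

(* From here on X is a parametrized hypersurface of the unit sphere of
   'rV_N, so N = n + 2. *)
Definition is_unit_normal (X : 'rV[R]_n -> 'rV[R]_N) (x : 'rV[R]_n)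
    (nu : 'rV[R]_N) : Prop :=
  [/\ dotv nu nu = 1, dotv nu (X x) = 0
    & forall i : 'I_n, dotv nu (partial i X x) = 0].

(* The unit normal is unique up to sign; the sign affects neither the
   vanishing of the mean curvature nor |A|^2, so it is picked pointwise. *)
Definition normal (X : 'rV[R]_n -> 'rV[R]_N) (x : 'rV[R]_n) : 'rV[R]_N :=
  xget 0 [set nu | is_unit_normal X x nu].

Definition second_ff (X : 'rV[R]_n -> 'rV[R]_N) (x : 'rV[R]_n) : 'M[R]_n :=
  \matrix_(i < n, j < n) dotv (partial i (partial j X) x) (normal X x).

(* Shape operator in the coordinate basis. *)
Definition shape (X : 'rV[R]_n -> 'rV[R]_N) (x : 'rV[R]_n) : 'M[R]_n :=
  invmx (metric X x) *m second_ff X x.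

Definition mean_curvature (X : 'rV[R]_n -> 'rV[R]_N) (x : 'rV[R]_n) : R :=
  \tr (shape X x) / n%:R.

(* The eigenvalues of the shape operator, with multiplicity, in some order. *)
Definition principal_curvatures (X : 'rV[R]_n -> 'rV[R]_N) (x : 'rV[R]_n) :
    'rV[R]_n :=
  xget 0 [set kappa : 'rV[R]_n |
            char_poly (shape X x) = \prod_(i < n) ('X - (kappa 0 i)%:P)].

Definition sqnormA (X : 'rV[R]_n -> 'rV[R]_N) (x : 'rV[R]_n) : R :=
  \sum_(i < n) (principal_curvatures X x 0 i) ^+ 2.

Definition stability (X : 'rV[R]_n -> 'rV[R]_N) (u : 'rV[R]_n -> R)
    (x : 'rV[R]_n) : R :=
  - laplacian X u x - n%:R * u x - sqnormA X x * u x.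

End LocalGeometry.

Definition sphere (R : realType) (k : nat) : Type :=
  {y : 'rV[R]_(1 + k) | dotv y y == 1}.

(* Inverse of the stereographic projection from the pole (-1, 0) if b = false,
   and from (1, 0) if b = true. *)
Definition stereo_vec (R : realType) (k : nat) (b : bool) (v : 'rV[R]_k) :
    'rV[R]_(1 + k) :=
  row_mx ((-1) ^+ b * ((1 - dotv v v) / (1 + dotv v v)))%:M
         ((2 / (1 + dotv v v)) *: v).

Lemma dotv_row_mx (R : realType) (k l : nat)
    (u u' : 'rV[R]_k) (v v' : 'rV[R]_l) :
  dotv (row_mx u v) (row_mx u' v') = dotv u u' + dotv v v'.
Proof.
rewrite /dotv big_split_ord /=; congr (_ + _); apply: eq_bigr => i _.
  by rewrite !row_mxEl.
by rewrite !row_mxEr.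
Qed.

Lemma dotv_scalar_mx (R : realType) (a b : R) :
  dotv (a%:M : 'rV[R]_1) b%:M = a * b.
Proof. by rewrite /dotv big_ord1 !mxE eqxx !mulr1n. Qed.

Lemma dotvZ (R : realType) (k : nat) (a : R) (v : 'rV[R]_k) :
  dotv (a *: v) (a *: v) = a ^+ 2 * dotv v v.
Proof.
by rewrite /dotv mulr_sumr; apply: eq_bigr => i _; rewrite !mxE; ring.
Qed.

Lemma dotv_ge0 (R : realType) (k : nat) (v : 'rV[R]_k) : 0 <= dotv v v.
Proof. by apply: sumr_ge0 => i _; rewrite -expr2 sqr_ge0. Qed.

Lemma stereo_vec_sphere (R : realType) (k : nat) (b : bool) (v : 'rV[R]_k) :
  dotv (stereo_vec b v) (stereo_vec b v) == 1.
Proof.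
apply/eqP; rewrite /stereo_vec dotv_row_mx dotv_scalar_mx dotvZ.
have h : 1 + dotv v v != 0 by rewrite gt_eqF// ltr_pwDl// dotv_ge0.
rewrite -expr2 exprMn sqrr_sign mul1r.
by field.
Qed.

Definition stereo (R : realType) (k : nat) (b : bool) (v : 'rV[R]_k) :
    sphere R k :=
  exist _ (stereo_vec b v) (stereo_vec_sphere b v).

Lemma stereo_cover (R : realType) (k : nat) (y : sphere R k) :
  exists (b : bool) (v : 'rV[R]_k), y = stereo b v.
Proof.
case: y => y hy.
suff [b [v E]] : exists b v, y = stereo_vec b v.
  exists b, v; rewrite /stereo; move: (stereo_vec_sphere b v); rewrite -E => h.
  by congr exist; exact: bool_irrelevance.
move/eqP: hy; rewrite -[y]hsubmxK; set a := lsubmx y; set w := rsubmx y.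
rewrite dotv_row_mx [a]mx11_scalar dotv_scalar_mx; set c := a 0 0 => hc.
pose b := c < 0; pose d := 1 + (-1) ^+ b * c.
have d0 : d != 0.
  rewrite gt_eqF// /d /b; case: (ltP c 0) => hc0; rewrite ?expr1 ?expr0.
    by lra.
  by rewrite mul1r ltr_pwDl.
exists b, (d^-1 *: w); rewrite /stereo_vec dotvZ.
have -> : dotv w w = d * (2 - d).
  rewrite (_ : dotv w w = 1 - c * c); last by rewrite -hc; ring.
  by rewrite /d; case: (b) => /=; rewrite ?expr1 ?expr0; ring.
have e : 1 + d^-1 ^+ 2 * (d * (2 - d)) = 2 / d by field.
have e1 : 2 / (2 / d) * d^-1 = 1 by field; rewrite d0.
have e2 : (1 - d^-1 ^+ 2 * (d * (2 - d))) / (2 / d) = d - 1.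
  by field; rewrite d0.
rewrite e scalerA e1 scale1r e2; congr row_mx; congr (_ %:M).
by rewrite /d addrC addKr mulrA -expr2 sqrr_sign mul1r.
Qed.

(* The circle R / T Z. *)
Definition circle_rel (R : realType) (T : R) : rel R :=
  fun s t => (s - t) / T \is a Num.int.

Lemma circle_rel_equiv (R : realType) (T : R) :
  equiv_class_of (circle_rel T).
Proof.
split=> [s|s t|t s r]; rewrite /circle_rel.
- by rewrite subrr mul0r.
- by rewrite -opprB mulNr rpredN.
- move=> h1 h2; rewrite (_ : s - r = (s - t) + (t - r)); last by ring.
  by rewrite mulrDl rpredD.
Qed.

Canonical circle_equiv (R : realType) (T : R) :=
  EquivRelPack (circle_rel_equiv T).

Definition circle (R : realType) (T : R) : Type :=
  {eq_quot (circle_equiv T)}.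

Definition prodM (R : realType) (k l : nat) (T : R) : Type :=
  sphere R k * sphere R l * circle T.

(* The charts, indexed by the projection poles on the two spheres; they are
   defined on all of R^n, n = k + l + 1, and their images cover prodM. *)
Definition chart (R : realType) (k l : nat) (T : R) (b : bool * bool)
    (x : 'rV[R]_(k + l + 1)) : prodM k l T :=
  (stereo b.1 (lsubmx (lsubmx x)),
   stereo b.2 (rsubmx (lsubmx x)),
   \pi_({eq_quot (circle_equiv T)}) (rsubmx x 0 0)).

Lemma chart_cover (R : realType) (k l : nat) (T : R) (p : prodM k l T) :
  exists b x, p = chart T b x.
Proof.
case: p => [[y z] s].
have [b [v ->]] := stereo_cover y; have [b' [v' ->]] := stereo_cover z.
exists (b, b'), (row_mx (row_mx v v') (repr s)%:M).
by rewrite /chart !row_mxKl !row_mxKr mxE eqxx mulr1n reprK.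
Qed.

Section Hypersurface.
Context {R : realType} {k l N : nat} {T : R}.

Definition smoothM (u : prodM k l T -> R) : Prop :=
  forall b, smooth (u \o chart T b).

(* Immersion of prodM into the unit sphere of 'rV_N. *)
Definition immersion (phi : prodM k l T -> 'rV[R]_N) : Prop :=
  [/\ forall p, dotv (phi p) (phi p) = 1,
      forall j : 'I_N, smoothM (fun p => phi p 0 j)
    & forall b x, row_free (jac (phi \o chart T b) x)].

Definition minimal (phi : prodM k l T -> 'rV[R]_N) : Prop :=
  forall b x, mean_curvature (phi \o chart T b) x = 0.

(* The smooth u with J(u) = lambda u; the equation is read in every chart. *)
Definition eigenspace_J (phi : prodM k l T -> 'rV[R]_N) (lambda : R) :
    set (prodM k l T -> R) :=
  [set u | smoothM u /\
     forall b x, stability (phi \o chart T b) (u \o chart T b) x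
                 = lambda * u (chart T b x)].

Definition is_eigenvalue_J (phi : prodM k l T -> 'rV[R]_N) (lambda : R) :
    Prop :=
  exists u, eigenspace_J phi lambda u /\ exists p, u p != 0.

(* The eigenspace has dimension at least m, i.e. contains m linearly
   independent functions. *)
Definition multiplicity_J_ge (phi : prodM k l T -> 'rV[R]_N) (lambda : R)
    (m : nat) : Prop :=
  exists u : 'I_m -> prodM k l T -> R,
    (forall i, eigenspace_J phi lambda (u i)) /\
    (forall c : 'I_m -> R,
       (forall p, \sum_(i < m) c i * u i p = 0) -> forall i, c i = 0).

End Hypersurface.

(* (y, z, t) |-> (f(t) y, f2(t) z, f1(t)), for T-periodic f, f2, f1: the value
   does not depend on the representative of t in R. *)
Definition phi (R : realType) (k l : nat) (T : R) (f f2 f1 : R -> R)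
    (p : prodM k l T) : 'rV[R]_((1 + k) + (1 + l) + 1) :=
  let t := repr p.2 in
  row_mx (row_mx (f t *: val p.1.1) (f2 t *: val p.1.2)) (f1 t)%:M.

(* Main.v *)
Require Import Defs.
From HB Require Import structures.
From mathcomp Require Import all_boot all_order all_algebra.
From mathcomp Require Import all_classical all_reals all_analysis.
From mathcomp Require Import ring lra.

Set Implicit Arguments.
Unset Strict Implicit.
Unset Printing Implicit Defensive.

Import Order.TTheory GRing.Theory Num.Theory.
Import numFieldNormedType.Exports.

Local Open Scope ring_scope.

(** Write gamma = (f, f2, f1) for the profile curve, which lies on the unit
    2-sphere, E = |gamma'|^2, and nu = gamma x gamma' / |gamma'|, with components
    [nu_y], [nu_z], [nu_t]. The unit normal of the hypersurface at (y, z, t) is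
    (nu_y y, nu_z z, nu_t). As n = k + l + 1, the equation J u = - n u means
    Delta u = - |A|^2 u. The components of the unit normal of a minimal
    hypersurface of a sphere satisfy it, which gives the functions y_i nu_y,
    z_j nu_z and nu_t. The other (k + 1) (l + 1) functions are y_i z_j G(t) with
    G = f^-k f2^-l, the inverse of the volume density of the orbits of
    O(k + 1) x O(l + 1).

    On u = P(y) Q(z) G(t) the Laplacian of the doubly warped metric separates
    ([laplacian_chart]). When P is 1 or a coordinate of the first sphere, an
    eigenfunction for 0 or k ([conformal_laplacian_ocoord]), and likewise for Q,
    the equation becomes an ordinary differential equation for G. In the
    orthonormal frame gamma, gamma' / |gamma'|, nu minimality says that the
    geodesic curvature of gamma is k nu_y / f + l nu_z / f2. For the components
    of nu the equation then follows from nu' = - curv gamma'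
    ([profile_laplacian_nu_y] and the two lemmas after it). For
    G = f^-k f2^-l one has G' = - H G with H = k f' / f + l f2' / f2, and the
    equation is the value of H' given by the same frame
    ([profile_laplacian_inv_vol]).

    The (k + 2) (l + 2) = (k + l + 3) + (k + 1) (l + 1) functions are indexed by
    pairs of options, [None] standing for the constant 1. Taking even and odd
    parts at opposite points of a coordinate axis isolates each of them
    ([ocoord_dual]), so they are independent because no profile vanishes
    identically: at a critical point of f, which exists by periodicity,
    nu_y^2 = 1 - f^2 > 0, and similarly for nu_z and nu_t ([profile_neq0]). *)

(** * Differentiation rules *)

Section Calculus.
Context {R : realType} {V : normedModType R}.
Implicit Types (F G : V -> R) (x v : V).

Lemma is_derive_addf F G x v a b :
  is_derive x v F a -> is_derive x v G b ->
  is_derive x v (fun y => F y + G y) (a + b).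
Proof. exact: is_deriveD. Qed.

Lemma is_derive_oppf F x v a :
  is_derive x v F a -> is_derive x v (fun y => - F y) (- a).
Proof. exact: is_deriveN. Qed.

Lemma is_derive_mulf F G x v a b :
  is_derive x v F a -> is_derive x v G b ->
  is_derive x v (fun y => F y * G y) (F x * b + G x * a).
Proof. exact: is_deriveM. Qed.

Lemma is_derive_expf F (m : nat) x v a :
  is_derive x v F a ->
  is_derive x v (fun y => F y ^+ m) (m%:R * F x ^+ m.-1 * a).
Proof.
move=> h; have := @is_deriveX R V F m x v a h.
rewrite (_ : F ^+ m = fun y => F y ^+ m) //.
by apply/funext => y; rewrite exprfctE.
Qed.

Lemma is_derive_invf F x v a :
  F x != 0 -> is_derive x v F a ->
  is_derive x v (fun y => (F y)^-1) (- (F x) ^- 2 * a).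
Proof.
move=> Fx0 h; apply: DeriveDef; first by apply: derivableV => //; exact: ex_derive.
by rewrite deriveV // derive_val.
Qed.

Lemma is_derive_sumf (m : nat) (F : 'I_m -> V -> R) (a : 'I_m -> R) x v :
  (forall i, is_derive x v (F i) (a i)) ->
  is_derive x v (fun y => \sum_i F i y) (\sum_i a i).
Proof.
move=> h; have -> : (fun y => \sum_i F i y) = \sum_i F i.
  by apply/funext => y; rewrite fct_sumE.
exact: is_derive_sum.
Qed.

Lemma is_derive_cstf (c : R) x v : is_derive x v (fun _ => c) 0.
Proof. exact: is_derive_cst. Qed.

Lemma is_derive_mxP (m p : nat) (M : V -> 'M[R]_(m, p)) x v (D : 'M[R]_(m, p)) :
  (forall i j, is_derive x v (fun y => M y i j) (D i j)) -> is_derive x v M D.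
Proof.
move=> h; have dM : derivable M x v.
  by apply/derivable_mxP => i j; exact: ex_derive.
apply: DeriveDef => //; rewrite derive_mx //.
by apply/matrixP => i j; rewrite mxE derive_val.
Qed.

Lemma is_derive_coord (m p : nat) (M : V -> 'M[R]_(m, p)) x v (D : 'M[R]_(m, p))
    i j :
  is_derive x v M D -> is_derive x v (fun y => M y i j) (D i j).
Proof.
move=> h; have dM : derivable M x v by exact: ex_derive.
apply: DeriveDef; first exact: (derivable_mxP M x v).1.
by rewrite -[D](@derive_val _ _ _ _ _ _ _ h) derive_mx // mxE.
Qed.

Lemma is_derive_dotv (p : nat) (F G : V -> 'rV[R]_p) x v (dF dG : 'rV[R]_p) :
  is_derive x v F dF -> is_derive x v G dG ->
  is_derive x v (fun y => dotv (F y) (G y)) (dotv (F x) dG + dotv dF (G x)).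
Proof.
move=> hF hG; rewrite /dotv -big_split /=; apply: is_derive_sumf => i.
apply: is_derive_eq (is_derive_mulf (is_derive_coord 0 i hF) (is_derive_coord 0 i hG)) _.
by rewrite [X in _ + X]mulrC.
Qed.

(** A directional derivative only involves the values along a line, and [L] maps
    a line to a line. *)
Lemma is_derive_lin (U W : normedModType R) (L : U -> V) (F : V -> W)
    (x v : U) (a : W) :
  (forall (h : R) y z, L (h *: y + z) = h *: L y + L z) ->
  is_derive (L x) (L v) F a -> is_derive x v (fun y => F (L y)) a.
Proof.
move=> linL.
have E : (fun h : R => h^-1 *: (((fun y => F (L y)) \o shift x) (h *: v) - F (L x))) =
         (fun h => h^-1 *: ((F \o shift (L x)) (h *: L v) - F (L x))).
  by apply/funext => h /=; rewrite linL.
by case=> h1 h2; split; rewrite /derivable /derive E.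
Qed.

Lemma is_derive_scalev (p : nat) (g : V -> R) (s : V -> 'rV[R]_p) x v a
    (d : 'rV[R]_p) :
  is_derive x v g a -> is_derive x v s d ->
  is_derive x v (fun y => g y *: s y) (a *: s x + g x *: d).
Proof.
move=> hg hs; apply: is_derive_mxP => i j.
have -> : (fun y => (g y *: s y) i j) = fun y => g y * s y i j.
  by apply/funext => y; rewrite mxE.
apply: is_derive_eq (is_derive_mulf hg (is_derive_coord i j hs)) _.
by rewrite !mxE; ring.
Qed.

Lemma is_derive_row_mx (p q : nat) (A : V -> 'rV[R]_p) (B : V -> 'rV[R]_q) x v
    (dA : 'rV[R]_p) (dB : 'rV[R]_q) :
  is_derive x v A dA -> is_derive x v B dB ->
  is_derive x v (fun y => row_mx (A y) (B y)) (row_mx dA dB).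
Proof.
move=> hA hB; apply: is_derive_mxP => i j; case: (split_ordP j) => j' ->.
  have -> : (fun y => row_mx (A y) (B y) i (lshift q j')) = fun y => A y i j'.
    by apply/funext => y; rewrite row_mxEl.
  by rewrite row_mxEl; exact: is_derive_coord.
have -> : (fun y => row_mx (A y) (B y) i (rshift p j')) = fun y => B y i j'.
  by apply/funext => y; rewrite row_mxEr.
by rewrite row_mxEr; exact: is_derive_coord.
Qed.

Lemma is_derive_scalar_mx1 (g : V -> R) x v a :
  is_derive x v g a -> is_derive x v (fun y => (g y)%:M : 'rV[R]_1) a%:M.
Proof.
move=> h; apply: is_derive_mxP => i j; rewrite !ord1.
have -> : (fun y => ((g y)%:M : 'rV[R]_1) 0 0) = g.
  by apply/funext => y; rewrite mxE mulr1n.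
by rewrite mxE mulr1n.
Qed.

End Calculus.

(** * Algebras of functions stable under differentiation *)

(** When the derivatives of the generators are polynomials in the generators, so
    are those of every function of the algebra ([gen_alg_derive]); hence all of
    them are smooth. *)
Inductive gen_alg (R : realType) (V : Type) (B : (V -> R) -> Prop) :
    (V -> R) -> Prop :=
| gen_base F : B F -> gen_alg B F
| gen_cst c : gen_alg B (fun _ => c)
| gen_add F G : gen_alg B F -> gen_alg B G -> gen_alg B (fun x => F x + G x)
| gen_mul F G : gen_alg B F -> gen_alg B G -> gen_alg B (fun x => F x * G x).

Section GenAlg.
Context {R : realType} {V : Type} {B : (V -> R) -> Prop}.
Implicit Types F G : V -> R.

Lemma gen_opp F : gen_alg B F -> gen_alg B (fun x => - F x).
Proof.
move=> h; rewrite (_ : (fun x => - F x) = fun x => -1 * F x).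
  by apply: gen_mul => //; exact: gen_cst.
by apply/funext => x; rewrite mulN1r.
Qed.

Lemma gen_sub F G :
  gen_alg B F -> gen_alg B G -> gen_alg B (fun x => F x - G x).
Proof. by move=> hF hG; apply: gen_add => //; exact: gen_opp. Qed.

Lemma gen_exp F (m : nat) : gen_alg B F -> gen_alg B (fun x => F x ^+ m).
Proof.
move=> h; elim: m => [|m IH]; first exact: (gen_cst B 1).
rewrite (_ : (fun x => F x ^+ m.+1) = fun x => F x * F x ^+ m); first exact: gen_mul.
by apply/funext => x; rewrite exprS.
Qed.

Lemma gen_sum (m : nat) (F : 'I_m -> V -> R) :
  (forall i, gen_alg B (F i)) -> gen_alg B (fun x => \sum_i F i x).
Proof.
elim: m F => [|m IH] F h.
  rewrite (_ : (fun x => _) = fun _ => 0); first exact: gen_cst.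
  by apply/funext => x; rewrite big_ord0.
rewrite (_ : (fun x => _) =
    fun x => \sum_(i < m) F (widen_ord (leqnSn m) i) x + F ord_max x).
  by apply: gen_add => //; apply: IH.
by apply/funext => x; rewrite big_ord_recr.
Qed.

End GenAlg.

(** The Leibniz rules propagate differentiability, and stability under the
    derivations along [v], from the generators to the whole algebra. *)
Lemma gen_alg_derive (R : realType) (V : normedModType R) (B : (V -> R) -> Prop) :
  (forall F x, B F -> differentiable F x) ->
  forall F, gen_alg B F ->
    (forall x, differentiable F x) /\
    forall v, (forall G, B G -> gen_alg B (fun x => 'D_v G x)) ->
      gen_alg B (fun x => 'D_v F x).
Proof.
move=> dB F; elim=> {F} [F BF|c|F G _ [dF IF] _ [dG IG]|F G aF [dF IF] aG [dG IG]].
- by split=> [x|v h]; [exact: dB | exact: h].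
- split=> // v _; have -> : (fun x => 'D_v (fun _ : V => c) x) = fun _ => 0.
    by apply/funext => x; exact: (derive_cst c).
  exact: gen_cst.
- split=> [x|v h]; first exact: (@differentiableD R V R F G).
  have -> : (fun x => 'D_v (fun y => F y + G y) x) = fun x => 'D_v F x + 'D_v G x.
    by apply/funext => x; apply: deriveD; exact: diff_derivable.
  by apply: gen_add; [exact: (IF v h) | exact: (IG v h)].
- split=> [x|v h]; first exact: (@differentiableM R V F G).
  have -> : (fun x => 'D_v (fun y => F y * G y) x) =
      fun x => F x * 'D_v G x + G x * 'D_v F x.
    by apply/funext => x; apply: deriveM; exact: diff_derivable.
  by apply: gen_add; apply: gen_mul => //; [exact: (IG v h) | exact: (IF v h)].
Qed.

Lemma smooth_gen_alg (R : realType) (n : nat) (B : ('rV[R]_n -> R) -> Prop) :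
  (forall F x, B F -> differentiable F x) ->
  (forall F i, B F -> gen_alg B (partial i F)) ->
  forall F, gen_alg B F -> smooth F.
Proof.
move=> dB pB F hF s; suff h : gen_alg B (foldr partial F s).
  by move=> x; exact: (gen_alg_derive dB h).1.
elim: s => //= i s IH; apply: (gen_alg_derive dB IH).2 => G BG.
exact: pB.
Qed.

Lemma smooth1_gen_alg (R : realType) (B : (R -> R) -> Prop) :
  (forall F x, B F -> derivable F x 1) ->
  (forall F, B F -> gen_alg B (derive1 F)) ->
  forall F, gen_alg B F -> smooth1 F.
Proof.
move=> dB pB F hF m; have dB' G x : B G -> differentiable G x.
  by move=> BG; apply/derivable1_diffP; exact: dB.
suff h : gen_alg B (derive1n m F).
  by move=> x; apply/derivable1_diffP; exact: (gen_alg_derive dB' h).1.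
elim: m => [|m IH] //.
have dE (G : R -> R) : derive1 G = fun x => 'D_1 G x.
  by apply/funext => x; rewrite derive1E.
rewrite derive1nS dE; apply: (gen_alg_derive dB' IH).2 => G BG.
by rewrite -dE; exact: pB.
Qed.

Lemma smooth_foldr (R : realType) (n : nat) (F : 'rV[R]_n -> R) (s : seq 'I_n) :
  smooth F -> smooth (foldr partial F s).
Proof. by move=> h t x; rewrite -foldr_cat; exact: h. Qed.

Lemma smooth_diff (R : realType) (n : nat) (F : 'rV[R]_n -> R) x :
  smooth F -> differentiable F x.
Proof. by move=> h; exact: (h [::]). Qed.

Lemma smooth_partial (R : realType) (n : nat) (F : 'rV[R]_n -> R) i :
  smooth F -> smooth (partial i F).
Proof. exact: (@smooth_foldr R n F [:: i]). Qed.

Lemma smooth_cst (R : realType) (n : nat) (c : R) :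
  smooth (fun _ : 'rV[R]_n => c).
Proof.
have := @smooth_gen_alg R n (fun _ => False).
by apply=> //; exact: gen_cst.
Qed.

Lemma smooth1_derive1 (R : realType) (G : R -> R) :
  smooth1 G -> smooth1 (derive1 G).
Proof. by move=> h m t; rewrite -derive1Sn; exact: h. Qed.

Lemma smooth1_is_derive (R : realType) (G : R -> R) (t : R) :
  smooth1 G -> is_derive t 1 G (derive1 G t).
Proof. by move=> h; rewrite derive1E; apply: derivableP; exact: (h 0%N). Qed.

(** * Smooth functions of one variable *)

Section Smooth1.
Context {R : realType}.
Implicit Types p : R -> R.

Lemma smooth1_alg p : gen_alg (@smooth1 R) p -> smooth1 p.
Proof.
apply: smooth1_gen_alg => [F x sF|F sF]; first exact: (sF 0%N).
exact/gen_base/smooth1_derive1.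
Qed.

Lemma smooth1_inv p : (forall t, p t != 0) -> smooth1 p -> smooth1 (fun t => (p t)^-1).
Proof.
move=> p0 sp; pose B F := smooth1 F \/ F = fun t => (p t)^-1.
have D (t : R) := is_derive_invf (p0 t) (smooth1_is_derive t sp).
apply: (@smooth1_gen_alg R B); last by apply: gen_base; right.
- by move=> F x [sF|->]; [exact: (sF 0%N) | have [] := D x].
- move=> F [sF|->]; first by apply: gen_base; left; exact: smooth1_derive1.
  have -> : derive1 (fun t => (p t)^-1) = fun t => -1 * (p t)^-1 ^+ 2 * derive1 p t.
    by apply/funext => t; rewrite derive1E (@derive_val _ _ _ _ _ _ _ (D t)) exprVn mulN1r.
  apply: gen_mul; last by apply: gen_base; left; exact: smooth1_derive1.
  by apply: gen_mul; [exact: gen_cst | apply/gen_exp/gen_base; right].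
Qed.

Lemma smooth1_sqrt p :
  smooth1 p -> (forall t, 0 < p t) -> smooth1 (fun t => Num.sqrt (p t)).
Proof.
move=> sp p0; pose q t := Num.sqrt (p t).
have q0 t : q t != 0 by rewrite gt_eqF // sqrtr_gt0.
pose B F := [\/ smooth1 F, F = q | F = fun t => (q t)^-1].
have D (t : R) : is_derive t 1 q (2^-1 * (q t)^-1 * derive1 p t).
  have h := @is_derive1_comp R Num.sqrt p t _ _ (is_derive1_sqrt (p0 t))
    (smooth1_is_derive t sp).
  by apply: is_derive_eq h _; rewrite invfM.
have DV (t : R) := is_derive_invf (q0 t) (D t).
have gV : gen_alg B (fun t => (q t)^-1) by apply: gen_base; constructor 3.
have gp : gen_alg B (derive1 p).
  by apply: gen_base; constructor 1; exact: smooth1_derive1.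
have gq : gen_alg B (fun t => 2^-1 * (q t)^-1 * derive1 p t).
  by apply: gen_mul => //; apply: gen_mul => //; exact: gen_cst.
apply: (@smooth1_gen_alg R B); last by apply: gen_base; constructor 2.
- by move=> F x [sF|->|->]; [exact: (sF 0%N) | have [] := D x | have [] := DV x].
- move=> F [sF|->|->]; first by apply: gen_base; constructor 1; exact: smooth1_derive1.
    have -> // : derive1 q = fun t => 2^-1 * (q t)^-1 * derive1 p t.
    by apply/funext => t; rewrite derive1E (@derive_val _ _ _ _ _ _ _ (D t)).
  have -> : derive1 (fun t => (q t)^-1) =
      fun t => -1 * (q t)^-1 ^+ 2 * (2^-1 * (q t)^-1 * derive1 p t).
    by apply/funext => t; rewrite derive1E (@derive_val _ _ _ _ _ _ _ (DV t)) exprVn mulN1r.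
  by apply: gen_mul => //; apply: gen_mul; [exact: gen_cst | exact: gen_exp].
Qed.

Lemma derive1_periodic p (T : R) :
  (forall t, p (t + T) = p t) -> forall t, derive1 p (t + T) = derive1 p t.
Proof.
move=> pT t; rewrite /derive1.
have -> // : (fun h => h^-1 *: (p (h + (t + T)) - p (t + T))) =
    (fun h => h^-1 *: (p (h + t) - p t)).
by apply/funext => h; rewrite addrA !pT.
Qed.

(** Rolle's theorem on one period. *)
Lemma periodic_critical_point p (T : R) : 0 < T -> smooth1 p ->
  (forall t, p (t + T) = p t) -> exists t, derive1 p t = 0.
Proof.
move=> T0 sp pT; have dp x : derivable p x 1 := sp 0%N x.
have pc : {within `[0, T], continuous p}%classic.
  by apply: derivable_within_continuous => x _; exact: dp.
have e : p 0 = p T by rewrite -[in RHS](add0r T) pT.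
have [c _ h] := Rolle T0 (fun x _ => dp x) pc e.
by exists c; rewrite derive1E derive_val.
Qed.

Lemma periodic_int p (T : R) (m : int) :
  (forall t, p (t + T) = p t) -> forall t, p (t + m%:~R * T) = p t.
Proof.
move=> pT; have pn (i : nat) t : p (t + i%:R * T) = p t.
  elim: i => [|i IH]; first by rewrite mul0r addr0.
  by rewrite -[RHS]IH -[RHS]pT -addrA -natr1 mulrDl mul1r.
case: m => i t; first exact: pn.
by rewrite NegzE mulrNz mulNr -(pn i.+1 (t - _)) subrK.
Qed.

End Smooth1.

Lemma is_derive_partial (R : realType) (n : nat) (W : normedModType R)
    (i : 'I_n) (F : 'rV[R]_n -> W) v a :
  is_derive v (delta_mx 0 i) F a -> partial i F v = a.
Proof. by move=> h; rewrite /partial derive_val. Qed.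

(** * Bilinearity of the scalar product *)

Section Dotv.
Context {R : realType} {p : nat}.
Implicit Types (u v w : 'rV[R]_p) (a : R).

Lemma dotvC u v : dotv u v = dotv v u.
Proof. by apply: eq_bigr => i _; rewrite mulrC. Qed.

Lemma dotvDl u v w : dotv (u + v) w = dotv u w + dotv v w.
Proof. by rewrite /dotv -big_split /=; apply: eq_bigr => i _; rewrite mxE mulrDl. Qed.

Lemma dotvZl a u w : dotv (a *: u) w = a * dotv u w.
Proof. by rewrite /dotv mulr_sumr; apply: eq_bigr => i _; rewrite mxE mulrA. Qed.

Lemma dotvDr u v w : dotv u (v + w) = dotv u v + dotv u w.
Proof. by rewrite dotvC dotvDl !(dotvC _ u). Qed.

Lemma dotvZr a u w : dotv u (a *: w) = a * dotv u w.
Proof. by rewrite dotvC dotvZl dotvC. Qed.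

Lemma dotvNl u w : dotv (- u) w = - dotv u w.
Proof. by rewrite -scaleN1r dotvZl mulN1r. Qed.

Lemma dotvNr u w : dotv u (- w) = - dotv u w.
Proof. by rewrite dotvC dotvNl dotvC. Qed.

Lemma dotv0l w : dotv (0 : 'rV[R]_p) w = 0.
Proof. by apply: big1 => i _; rewrite mxE mul0r. Qed.

Lemma dotv_delta (i : 'I_p) w : dotv (delta_mx 0 i) w = w 0 i.
Proof.
rewrite /dotv (bigD1 i) //= mxE !eqxx mul1r big1 ?addr0 // => j ji.
by rewrite mxE eqxx (negPf ji) mul0r.
Qed.

Lemma dotv_mul u v : dotv u v = (u *m v^T) 0 0.
Proof. by rewrite mxE; apply: eq_bigr => i _; rewrite mxE. Qed.

End Dotv.

(** * Stereographic charts of the sphere *)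

Section Stereo.
Context {R : realType} {k : nat}.
Implicit Types (v w z beta : 'rV[R]_k) (b : bool).

(** The conformal factor: [dotv (stereo_d b w v) (stereo_d b z v)] is
    [rho v ^+ 2 * dotv w z]. *)
Definition rho v : R := 2 / (1 + dotv v v).

Lemma rho_gt0 v : 0 < rho v.
Proof. by rewrite divr_gt0 // ltr_pwDl // dotv_ge0. Qed.

Lemma rho_dotv v : rho v * dotv v v = 2 - rho v.
Proof.
have h : 1 + dotv v v != 0 by rewrite gt_eqF // ltr_pwDl // dotv_ge0.
by rewrite /rho; field.
Qed.

Lemma is_derive_rho v w : is_derive v w rho (- rho v ^+ 2 * dotv v w).
Proof.
have h : 1 + dotv v v != 0 by rewrite gt_eqF // ltr_pwDl // dotv_ge0.
have d1 := is_derive_addf (is_derive_cstf 1 v w)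
  (is_derive_dotv (is_derive_id v w) (is_derive_id v w)).
have := is_derive_mulf (is_derive_cstf 2 v w)
  (is_derive_invf (F := fun v => 1 + dotv v v) h d1).
move/is_derive_eq; apply; rewrite /=.
by rewrite /rho (dotvC w v); field.
Qed.

(** The linear functions of the ambient space, read in a stereographic chart:
    [alpha] is, up to the sign of the pole, the coefficient along the axis of
    projection, and [beta] the horizontal part. *)
Definition height (alpha : R) beta v : R :=
  alpha * (rho v - 1) + rho v * dotv beta v.

Lemma is_derive_height alpha beta v w :
  is_derive v w (height alpha beta)
    (rho v * dotv beta w - rho v * dotv v w * (height alpha beta v + alpha)).
Proof.
have dr := is_derive_rho v w.
have db : is_derive v w (fun v => dotv beta v) (dotv beta w).
  apply: is_derive_eq (is_derive_dotv (is_derive_cst beta v w) (is_derive_id v w)) _.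
  by rewrite dotv0l addr0.
have := is_derive_addf (is_derive_mulf (is_derive_cstf alpha v w)
  (is_derive_addf dr (is_derive_cstf (-1) v w))) (is_derive_mulf dr db).
move/is_derive_eq; apply.
by rewrite /height; ring.
Qed.

Definition stereo_d b w v : 'rV[R]_(1 + k) :=
  row_mx (- ((-1) ^+ b * rho v ^+ 2 * dotv v w))%:M
         (rho v *: w - (rho v ^+ 2 * dotv v w) *: v).

Lemma stereo_vecE b v :
  stereo_vec b v = row_mx ((-1) ^+ b * (rho v - 1))%:M (rho v *: v).
Proof.
have h : 1 + dotv v v != 0 by rewrite gt_eqF // ltr_pwDl // dotv_ge0.
congr (row_mx (_ * _)%:M _).
by rewrite /rho; field.
Qed.

Lemma stereo_vec_height b v c :
  stereo_vec b v 0 c =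
  height ((-1) ^+ b * (lsubmx (delta_mx 0 c : 'rV[R]_(1 + k))) 0 0)
         (rsubmx (delta_mx 0 c : 'rV[R]_(1 + k))) v.
Proof.
rewrite stereo_vecE -[LHS]dotv_delta -[delta_mx 0 c]hsubmxK dotv_row_mx row_mxKl row_mxKr.
rewrite [X in dotv X]mx11_scalar dotv_scalar_mx dotvZr /height; congr (_ + _).
by ring.
Qed.

Lemma stereo_d_height b v w c :
  stereo_d b w v 0 c =
  let alpha := (-1) ^+ b * (lsubmx (delta_mx 0 c : 'rV[R]_(1 + k))) 0 0 in
  let beta := rsubmx (delta_mx 0 c : 'rV[R]_(1 + k)) in
  rho v * dotv beta w - rho v * dotv v w * (height alpha beta v + alpha).
Proof.
rewrite /stereo_d -[LHS]dotv_delta -[delta_mx 0 c]hsubmxK dotv_row_mx row_mxKl row_mxKr.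
rewrite [X in dotv X]mx11_scalar dotv_scalar_mx dotvDr dotvNr !dotvZr /height.
by cbv zeta; ring.
Qed.

Lemma is_derive_stereo_vec b v w :
  is_derive v w (stereo_vec b) (stereo_d b w v).
Proof.
apply: is_derive_mxP => i c; rewrite !ord1 stereo_d_height.
rewrite (_ : (fun y => stereo_vec b y 0 c) =
  height ((-1) ^+ b * (lsubmx (delta_mx 0 c : 'rV[R]_(1 + k))) 0 0)
         (rsubmx (delta_mx 0 c : 'rV[R]_(1 + k)))).
  exact: is_derive_height.
by apply/funext => y; rewrite stereo_vec_height.
Qed.

Lemma dotv_stereo_vec b v : dotv (stereo_vec b v) (stereo_vec b v) = 1.
Proof. exact/eqP/stereo_vec_sphere. Qed.

Lemma dotv_stereo_d b v w z :
  dotv (stereo_d b w v) (stereo_d b z v) = rho v ^+ 2 * dotv w z.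
Proof.
rewrite /stereo_d dotv_row_mx dotv_scalar_mx mulrNN.
rewrite !(dotvDl, dotvDr, dotvNl, dotvNr, dotvZl, dotvZr) (dotvC w v).
have e : ((-1) ^+ b : R) ^+ 2 = 1 by rewrite sqrr_sign.
have h := rho_dotv v.
transitivity (rho v ^+ 2 * dotv w z + rho v ^+ 3 * dotv v w * dotv v z *
   (((-1) ^+ b) ^+ 2 * rho v - 2 + rho v * dotv v v)); first by ring.
by rewrite e h; ring.
Qed.

Lemma dotv_stereo_vec_d b v w : dotv (stereo_vec b v) (stereo_d b w v) = 0.
Proof.
rewrite stereo_vecE /stereo_d dotv_row_mx dotv_scalar_mx.
rewrite !(dotvDr, dotvNr, dotvZl, dotvZr).
have e : ((-1) ^+ b : R) ^+ 2 = 1 by rewrite sqrr_sign.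
have h := rho_dotv v.
transitivity (rho v ^+ 2 * dotv v w *
   (1 - ((-1) ^+ b) ^+ 2 * (rho v - 1) - rho v * dotv v v)); first by ring.
by rewrite e h; ring.
Qed.

Lemma derivable_stereo_d b v w z : derivable (stereo_d b w) v z.
Proof.
apply/derivable_mxP => i c; rewrite ord1.
set alpha := (-1) ^+ b * (lsubmx (delta_mx 0 c : 'rV[R]_(1 + k))) 0 0.
set beta := rsubmx (delta_mx 0 c : 'rV[R]_(1 + k)).
have -> : (fun y => stereo_d b w y 0 c) = fun y : 'rV[R]_k =>
    rho y * dotv beta w - rho y * dotv y w * (height alpha beta y + alpha).
  by apply/funext => y; rewrite stereo_d_height.
have dr := is_derive_rho v z; have dh := is_derive_height alpha beta v z.
have dd := is_derive_dotv (is_derive_id v z) (is_derive_cst w v z).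
have := is_derive_addf (is_derive_mulf dr (is_derive_cstf (dotv beta w) v z))
  (is_derive_oppf (is_derive_mulf (is_derive_mulf dr dd)
    (is_derive_addf dh (is_derive_cstf alpha v z)))).
by case.
Qed.

(** The second fundamental form of the unit sphere is minus its metric. *)
Lemma dotv_stereo_vec_dd b v w z :
  dotv (stereo_vec b v) ('D_z (stereo_d b w) v) = - rho v ^+ 2 * dotv z w.
Proof.
have h := is_derive_dotv (is_derive_stereo_vec b v z)
  (derivableP (@derivable_stereo_d b v w z)).
have e : (fun v => dotv (stereo_vec b v) (stereo_d b w v)) = cst 0.
  by apply/funext => y; rewrite dotv_stereo_vec_d.
rewrite e in h; have := @derive_val _ _ _ _ _ _ _ h.
rewrite derive_cst dotv_stereo_d => /esym/eqP.
by rewrite addr_eq0 mulNr => /eqP.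
Qed.

(** The Laplacian of the metric [rho v ^+ 2] times the Euclidean one, that is of
    the round sphere. *)
Definition conformal_laplacian (P : 'rV[R]_k -> R) v : R :=
  (rho v) ^- 2 * \sum_i (partial i (partial i P) v
                         + (k%:R - 2) * (partial i rho v / rho v) * partial i P v).

Lemma partial_rho i v : partial i rho v = - rho v ^+ 2 * v 0 i.
Proof.
by rewrite (is_derive_partial (is_derive_rho _ _)) -dotv_delta (dotvC v).
Qed.

Lemma partial_height i alpha beta v :
  partial i (height alpha beta) v =
  rho v * beta 0 i - rho v * v 0 i * (height alpha beta v + alpha).
Proof.
rewrite (is_derive_partial (is_derive_height _ _ _ _)).
by rewrite -!(dotv_delta i) !(dotvC (delta_mx 0 i)).
Qed.

Lemma partial2_height i alpha beta v :
  partial i (partial i (height alpha beta)) v =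
  - 2 * rho v ^+ 2 * (beta 0 i * v 0 i) - rho v * (height alpha beta v + alpha)
  + 2 * rho v ^+ 2 * (v 0 i * v 0 i) * (height alpha beta v + alpha).
Proof.
have -> : partial i (height alpha beta) = fun v : 'rV[R]_k =>
    rho v * beta 0 i - rho v * v 0 i * (height alpha beta v + alpha).
  by apply/funext => y; exact: partial_height.
pose e : 'rV[R]_k := delta_mx 0 i.
have dr := is_derive_rho v e; have dh := is_derive_height alpha beta v e.
have dv : is_derive v e (fun y : 'rV[R]_k => y 0 i) 1.
  apply: is_derive_eq (is_derive_coord 0 i (is_derive_id v e)) _.
  by rewrite mxE !eqxx.
have := is_derive_addf (is_derive_mulf dr (is_derive_cstf (beta 0 i) v e))
  (is_derive_oppf (is_derive_mulf (is_derive_mulf dr dv)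
    (is_derive_addf dh (is_derive_cstf alpha v e)))).
move/is_derive_partial => ->.
by rewrite /e !(dotvC _ (delta_mx 0 i)) !dotv_delta; ring.
Qed.

Lemma conformal_laplacian_cst (c : R) v : conformal_laplacian (fun _ => c) v = 0.
Proof.
have p0 a i : partial i (fun _ : 'rV[R]_k => a) = fun _ => 0.
  by apply/funext => y; rewrite /partial; exact: (derive_cst a).
by rewrite /conformal_laplacian big1 ?mulr0 // => i _; rewrite !p0 mulr0 addr0.
Qed.

(** After summation over the coordinates, only [dotv v v] and [dotv beta v]
    remain; the relation [rho_dotv] eliminates the first one. *)
Lemma conformal_laplacian_height alpha beta v :
  conformal_laplacian (height alpha beta) v = - k%:R * height alpha beta v.
Proof.
have r0 : rho v != 0 by rewrite gt_eqF // rho_gt0.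
rewrite /conformal_laplacian; set P := height alpha beta v.
transitivity (rho v ^- 2 * (- k%:R * (rho v ^+ 2 * dotv beta v)
    + k%:R * rho v ^+ 2 * dotv v v * (P + alpha) - k%:R * rho v * (P + alpha))).
  congr (_ * _); transitivity (\sum_(i < k)
     (- k%:R * rho v ^+ 2 * (beta 0 i * v 0 i)
      + k%:R * rho v ^+ 2 * (P + alpha) * (v 0 i * v 0 i)
      - rho v * (P + alpha))).
    apply: eq_bigr => i _.
    by rewrite partial2_height partial_rho partial_height -/P; field.
  rewrite !big_split /= -!mulr_sumr sumr_const card_ord -mulr_natl.
  by rewrite /dotv; ring.
have e : k%:R * rho v ^+ 2 * dotv v v = k%:R * rho v * (2 - rho v).
  by rewrite -rho_dotv; ring.
rewrite e; have -> : rho v ^+ 2 * dotv beta v = rho v * (P - alpha * (rho v - 1)).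
  by rewrite /P /height; ring.
by field.
Qed.


(** The coordinates and the conformal factor generate an algebra which, by
    [partial_rho], is stable under the partial derivatives. *)
Definition stereo_gen (F : 'rV[R]_k -> R) : Prop :=
  F = rho \/ exists i, F = fun v => v 0 i.

Lemma smooth_height alpha beta : smooth (height alpha beta).
Proof.
apply: (@smooth_gen_alg R k stereo_gen).
- move=> F v [->|[i ->]]; last exact: differentiable_coord.
  have h (y : 'rV[R]_k) : 1 + dotv y y != 0 by rewrite gt_eqF // ltr_pwDl // dotv_ge0.
  have dc i : differentiable (fun y : 'rV[R]_k => y 0 i) v.
    exact: differentiable_coord.
  have dd : differentiable (fun y : 'rV[R]_k => \sum_i y 0 i * y 0 i) v.
    have -> : (fun y : 'rV[R]_k => \sum_i y 0 i * y 0 i) =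
        \sum_i (fun y : 'rV[R]_k => y 0 i * y 0 i).
      by apply/funext => y; rewrite fct_sumE.
    by apply: differentiable_sum => i; exact: differentiableM.
  have d1 : differentiable (fun y : 'rV[R]_k => 1 + dotv y y) v.
    exact: differentiableD.
  have d2 := differentiableV d1 (h v).
  exact: (differentiableM (f := fun _ => 2) (differentiable_cst _ v) d2).
- move=> F i [->|[j ->]].
    have -> : partial i rho = fun v : 'rV[R]_k => -1 * (rho v ^+ 2 * v 0 i).
      by apply/funext => v; rewrite partial_rho; ring.
    apply: gen_mul; first exact: gen_cst.
    apply: gen_mul; last by apply: gen_base; right; exists i.
    by apply: gen_exp; apply: gen_base; left.
  have -> : partial i (fun v : 'rV[R]_k => v 0 j) = fun=> (delta_mx 0 i : 'rV[R]_k) 0 j.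
    apply/funext => v; apply: is_derive_partial.
    exact: (is_derive_coord 0 j (is_derive_id v (delta_mx 0 i))).
  exact: gen_cst.
- have gr : gen_alg stereo_gen rho by apply: gen_base; left.
  apply: gen_add; apply: gen_mul => //; first exact: gen_cst.
    by apply: gen_sub => //; exact: gen_cst.
  apply: gen_sum => i; apply: gen_mul; first exact: gen_cst.
  by apply: gen_base; right; exists i.
Qed.

End Stereo.

(** * Separated functions on the charts *)

Section Blocks.
Context {R : realType} {k l : nat}.
Implicit Types (x : 'rV[R]_(k + l + 1)).

Definition coord_y x : 'rV[R]_k := lsubmx (lsubmx x).
Definition coord_z x : 'rV[R]_l := rsubmx (lsubmx x).
Definition coord_t x : R := rsubmx x 0 0.

Definition idx_y (i : 'I_k) : 'I_(k + l + 1) := lshift 1 (lshift l i).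
Definition idx_z (j : 'I_l) : 'I_(k + l + 1) := lshift 1 (rshift k j).
Definition idx_t : 'I_(k + l + 1) := rshift (k + l) ord0.

Lemma idxP (P : 'I_(k + l + 1) -> Prop) :
  (forall i, P (idx_y i)) -> (forall j, P (idx_z j)) -> P idx_t -> forall m, P m.
Proof.
move=> Py Pz Pt m; case: (split_ordP m) => [m' ->|j ->]; last by rewrite ord1.
by case: (split_ordP m') => j ->; [exact: Py | exact: Pz].
Qed.

Lemma sum_idx (F : 'I_(k + l + 1) -> R) :
  \sum_m F m = \sum_i F (idx_y i) + \sum_j F (idx_z j) + F idx_t.
Proof. by rewrite !big_split_ord /= big_ord1. Qed.

Lemma coord_y_lin (h : R) x x' : coord_y (h *: x + x') = h *: coord_y x + coord_y x'.
Proof. by apply/rowP => i; rewrite !mxE. Qed.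

Lemma coord_z_lin (h : R) x x' : coord_z (h *: x + x') = h *: coord_z x + coord_z x'.
Proof. by apply/rowP => i; rewrite !mxE. Qed.

Lemma coord_t_lin (h : R) x x' : coord_t (h *: x + x') = h *: coord_t x + coord_t x'.
Proof. rewrite /coord_t !mxE. by []. Qed.

Lemma coord_idx_y i :
  let e := delta_mx 0 (idx_y i) in
  (coord_y e = delta_mx 0 i) * (coord_z e = 0) * (coord_t e = 0).
Proof.
do 2?split; last by rewrite /coord_t !mxE eq_rlshift.
- by apply/rowP => j; rewrite !mxE !eq_lshift.
- by apply/rowP => j; rewrite !mxE eq_lshift eq_rlshift.
Qed.

Lemma coord_idx_z j :
  let e := delta_mx 0 (idx_z j) in
  (coord_y e = 0) * (coord_z e = delta_mx 0 j) * (coord_t e = 0).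
Proof.
do 2?split; last by rewrite /coord_t !mxE eq_rlshift.
- by apply/rowP => i; rewrite !mxE eq_lshift eq_lrshift.
- by apply/rowP => i; rewrite !mxE eq_lshift eq_rshift.
Qed.

Lemma coord_idx_t :
  let e := delta_mx 0 idx_t in
  (coord_y e = 0) * (coord_z e = 0) * (coord_t e = 1).
Proof.
do 2?split; last by rewrite /coord_t !mxE !eqxx.
- by apply/rowP => i; rewrite !mxE eq_lrshift.
- by apply/rowP => i; rewrite !mxE eq_lrshift.
Qed.

(** Metric coefficients, coordinates of the immersion and eigenfunctions are all
    of this form, which partial differentiation preserves. *)
Definition sep (P : 'rV[R]_k -> R) (Q : 'rV[R]_l -> R) (G : R -> R) x : R :=
  P (coord_y x) * Q (coord_z x) * G (coord_t x).

Lemma partial_sep_y i P Q G : (forall v, derivable P v (delta_mx 0 i)) ->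
  partial (idx_y i) (sep P Q G) = sep (partial i P) Q G.
Proof.
move=> dP; apply/funext => x; have [[ey ez] et] := coord_idx_y i.
apply: is_derive_partial; set e := delta_mx _ _ in ey ez et *.
have h1 : is_derive x e (fun y => P (coord_y y)) (partial i P (coord_y x)).
  apply: is_derive_lin; first exact: coord_y_lin.
  by rewrite ey; exact: derivableP.
have h2 : is_derive x e (fun y => Q (coord_z y)) 0.
  by apply: is_derive_lin; [exact: coord_z_lin | rewrite ez; exact: is_derive0].
have h3 : is_derive x e (fun y => G (coord_t y)) 0.
  by apply: is_derive_lin; [exact: coord_t_lin | rewrite et; exact: is_derive0].
apply: is_derive_eq (is_derive_mulf (is_derive_mulf h1 h2) h3) _.
by rewrite /sep; ring.
Qed.

Lemma partial_sep_z j P Q G : (forall v, derivable Q v (delta_mx 0 j)) ->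
  partial (idx_z j) (sep P Q G) = sep P (partial j Q) G.
Proof.
move=> dQ; apply/funext => x; have [[ey ez] et] := coord_idx_z j.
apply: is_derive_partial; set e := delta_mx _ _ in ey ez et *.
have h1 : is_derive x e (fun y => P (coord_y y)) 0.
  by apply: is_derive_lin; [exact: coord_y_lin | rewrite ey; exact: is_derive0].
have h2 : is_derive x e (fun y => Q (coord_z y)) (partial j Q (coord_z x)).
  apply: is_derive_lin; first exact: coord_z_lin.
  by rewrite ez; exact: derivableP.
have h3 : is_derive x e (fun y => G (coord_t y)) 0.
  by apply: is_derive_lin; [exact: coord_t_lin | rewrite et; exact: is_derive0].
apply: is_derive_eq (is_derive_mulf (is_derive_mulf h1 h2) h3) _.
by rewrite /sep; ring.
Qed.

Lemma partial_sep_t P Q (G : R -> R) : (forall t, derivable G t 1) ->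
  partial idx_t (sep P Q G) = sep P Q (derive1 G).
Proof.
move=> dG; apply/funext => x; have [[ey ez] et] := coord_idx_t.
apply: is_derive_partial; set e := delta_mx _ _ in ey ez et *.
have h1 : is_derive x e (fun y => P (coord_y y)) 0.
  by apply: is_derive_lin; [exact: coord_y_lin | rewrite ey; exact: is_derive0].
have h2 : is_derive x e (fun y => Q (coord_z y)) 0.
  by apply: is_derive_lin; [exact: coord_z_lin | rewrite ez; exact: is_derive0].
have h3 : is_derive x e (fun y => G (coord_t y)) (derive1 G (coord_t x)).
  apply: is_derive_lin; first exact: coord_t_lin.
  by rewrite et derive1E; exact: derivableP.
apply: is_derive_eq (is_derive_mulf (is_derive_mulf h1 h2) h3) _.
by rewrite /sep; ring.
Qed.

Lemma smooth_sep P Q G : smooth P -> smooth Q -> smooth1 G -> smooth (sep P Q G).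
Proof.
move=> sP sQ sG s; elim/last_ind: s P Q G sP sQ sG => [|s m IH] P Q G sP sQ sG x.
  have dx : differentiable (lsubmx : 'rV[R]_(k + l + 1) -> 'rV[R]_(k + l)) x.
    exact: differentiable_lsubmx.
  have dy : differentiable coord_y x.
    exact: differentiable_comp dx (differentiable_lsubmx (lsubmx x)).
  have dz : differentiable coord_z x.
    exact: differentiable_comp dx (differentiable_rsubmx (lsubmx x)).
  have dt : differentiable coord_t x.
    by rewrite (_ : coord_t = (fun y => y 0 (rshift (k + l) 0)));
      [exact: differentiable_coord | apply/funext => y; rewrite /coord_t mxE].
  have dP : differentiable (P \o coord_y) x.
    by apply: differentiable_comp => //; exact: smooth_diff.
  have dQ : differentiable (Q \o coord_z) x.
    by apply: differentiable_comp => //; exact: smooth_diff.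
  have dG : differentiable (G \o coord_t) x.
    by apply: differentiable_comp => //; apply/derivable1_diffP; exact: (sG 0%N).
  exact: differentiableM (differentiableM dP dQ) dG.
rewrite foldr_rcons; elim/idxP: m => [i|j|].
- rewrite partial_sep_y; first by apply: IH => //; exact: smooth_partial.
  by move=> v; apply: diff_derivable; exact: smooth_diff.
- rewrite partial_sep_z; first by apply: IH => //; exact: smooth_partial.
  by move=> v; apply: diff_derivable; exact: smooth_diff.
- rewrite partial_sep_t; first by apply: IH => //; exact: smooth1_derive1.
  exact: (sG 0%N).
Qed.

(** The vector analogue of [sep], with values in the product of the Euclidean
    spaces of the two spheres and of the axis. *)
Definition vsep {p q : nat} (g1 : R -> R) (s1 : 'rV[R]_k -> 'rV[R]_p)
    (g2 : R -> R) (s2 : 'rV[R]_l -> 'rV[R]_q) (g3 : R -> R) x :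
    'rV[R]_(p + q + 1) :=
  row_mx (row_mx (g1 (coord_t x) *: s1 (coord_y x))
                 (g2 (coord_t x) *: s2 (coord_z x)))
         (g3 (coord_t x))%:M.

Lemma dotv_vsep (p q : nat) g1 (s1 : 'rV[R]_k -> 'rV[R]_p)
    g2 (s2 : 'rV[R]_l -> 'rV[R]_q) g3 g1' s1' g2' s2' g3' x :
  dotv (vsep g1 s1 g2 s2 g3 x) (vsep g1' s1' g2' s2' g3' x) =
  g1 (coord_t x) * g1' (coord_t x) * dotv (s1 (coord_y x)) (s1' (coord_y x))
  + g2 (coord_t x) * g2' (coord_t x) * dotv (s2 (coord_z x)) (s2' (coord_z x))
  + g3 (coord_t x) * g3' (coord_t x).
Proof. by rewrite /vsep !dotv_row_mx !dotvZl !dotvZr dotv_scalar_mx !mulrA. Qed.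

Lemma is_derive_vsep (p q : nat) g1 (s1 : 'rV[R]_k -> 'rV[R]_p)
    g2 (s2 : 'rV[R]_l -> 'rV[R]_q) g3 x e a1 a2 a3 d1 d2 :
  is_derive (coord_t x) (coord_t e) g1 a1 -> is_derive (coord_y x) (coord_y e) s1 d1 ->
  is_derive (coord_t x) (coord_t e) g2 a2 -> is_derive (coord_z x) (coord_z e) s2 d2 ->
  is_derive (coord_t x) (coord_t e) g3 a3 ->
  is_derive x e (vsep g1 s1 g2 s2 g3)
    (row_mx (row_mx (a1 *: s1 (coord_y x) + g1 (coord_t x) *: d1)
                    (a2 *: s2 (coord_z x) + g2 (coord_t x) *: d2)) a3%:M).
Proof.
move=> h1 h2 h3 h4 h5; apply: is_derive_row_mx.
  apply: is_derive_row_mx.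
    by apply: is_derive_scalev; apply: is_derive_lin => //;
      [exact: coord_t_lin | exact: coord_y_lin].
  by apply: is_derive_scalev; apply: is_derive_lin => //;
    [exact: coord_t_lin | exact: coord_z_lin].
by apply: is_derive_scalar_mx1; apply: is_derive_lin => //; exact: coord_t_lin.
Qed.

Lemma partial_vsep_y (p q : nat) i g1 (s1 d1 : 'rV[R]_k -> 'rV[R]_p)
    g2 (s2 : 'rV[R]_l -> 'rV[R]_q) g3 :
  (forall v, is_derive v (delta_mx 0 i) s1 (d1 v)) ->
  partial (idx_y i) (vsep g1 s1 g2 s2 g3) =
  vsep g1 d1 (fun=> 0) s2 (fun=> 0).
Proof.
move=> h; apply/funext => x; have [[ey ez] et] := coord_idx_y i.
apply: is_derive_partial; apply: is_derive_eq.
  by apply: is_derive_vsep; rewrite ?ey ?ez ?et; try exact: is_derive0; exact: h.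
by rewrite /vsep !scale0r !add0r scaler0.
Qed.

Lemma partial_vsep_z (p q : nat) j g1 (s1 : 'rV[R]_k -> 'rV[R]_p)
    g2 (s2 d2 : 'rV[R]_l -> 'rV[R]_q) g3 :
  (forall v, is_derive v (delta_mx 0 j) s2 (d2 v)) ->
  partial (idx_z j) (vsep g1 s1 g2 s2 g3) =
  vsep (fun=> 0) s1 g2 d2 (fun=> 0).
Proof.
move=> h; apply/funext => x; have [[ey ez] et] := coord_idx_z j.
apply: is_derive_partial; apply: is_derive_eq.
  by apply: is_derive_vsep; rewrite ?ey ?ez ?et; try exact: is_derive0; exact: h.
by rewrite /vsep !scale0r !add0r scaler0.
Qed.

Lemma partial_vsep_t (p q : nat) (g1 : R -> R) (s1 : 'rV[R]_k -> 'rV[R]_p)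
    (g2 : R -> R) (s2 : 'rV[R]_l -> 'rV[R]_q) (g3 : R -> R) :
  (forall t, derivable g1 t 1) -> (forall t, derivable g2 t 1) ->
  (forall t, derivable g3 t 1) ->
  partial idx_t (vsep g1 s1 g2 s2 g3) =
  vsep (derive1 g1) s1 (derive1 g2) s2 (derive1 g3).
Proof.
move=> h1 h2 h3; apply/funext => x; have [[ey ez] et] := coord_idx_t.
have d (g : R -> R) : (forall t, derivable g t 1) ->
    is_derive (coord_t x) 1 g (derive1 g (coord_t x)).
  by move=> h; rewrite derive1E; exact: derivableP.
apply: is_derive_partial; apply: is_derive_eq.
  by apply: is_derive_vsep; rewrite ?ey ?ez ?et; try exact: is_derive0; exact: d.
by rewrite /vsep !scaler0 !addr0.
Qed.

End Blocks.

(** * Hypersurfaces in coordinates that diagonalise both fundamental forms *)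

Lemma invmx_diag (F : fieldType) (n : nat) (d : 'rV[F]_n) :
  (forall i, d 0 i != 0) -> invmx (diag_mx d) = diag_mx (\row_i (d 0 i)^-1).
Proof.
move=> d0; have e : diag_mx d *m diag_mx (\row_i (d 0 i)^-1) = 1%:M.
  rewrite mulmx_diag -diag_const_mx; congr diag_mx.
  by apply/rowP => i; rewrite !mxE mulfV.
have [ud _] := mulmx1_unit e.
by rewrite -[RHS]mul1mx -(mulVmx ud) -mulmxA e mulmx1.
Qed.

Section DiagonalMetric.
Context {R : realType} {n N : nat} {X : 'rV[R]_n -> 'rV[R]_N}.
Context {d : 'I_n -> 'rV[R]_n -> R}.
Hypothesis metric_d : forall x, metric X x = diag_mx (\row_i d i x).
Hypothesis d_neq0 : forall i x, d i x != 0.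

Let partial_metric m i j x :
  partial m (fun y => metric X y i j) x = partial m (d i) x *+ (i == j).
Proof.
have -> : (fun y => metric X y i j) = fun y => d i y *+ (i == j).
  by apply/funext => y; rewrite metric_d !mxE.
by case: (i == j); rewrite ?mulr1n // mulr0n; exact: (derive_cst 0).
Qed.

Let invmx_metric x : invmx (metric X x) = diag_mx (\row_i (d i x)^-1).
Proof.
rewrite metric_d invmx_diag => [|i]; last by rewrite mxE.
by congr diag_mx; apply/rowP => i; rewrite !mxE.
Qed.

Let christoffel_diag x m i : christoffel X x m i i =
  (d m x)^-1 * (partial i (d i) x *+ (i == m) - 2^-1 * partial m (d i) x).
Proof.
rewrite /christoffel (bigD1 m) //= big1 ?addr0 => [|j jm].
  rewrite invmx_metric !mxE eqxx mulr1n !partial_metric eqxx mulr1n.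
  by case: (i == m); rewrite ?mulr1n ?mulr0n; field.
by rewrite invmx_metric !mxE eq_sym (negPf jm) mulr0n mul0r.
Qed.

(** In the trace only the symbols Gamma^m_ii occur, and they contribute the
    logarithmic derivatives of the metric coefficients. *)
Lemma laplacian_diag (u : 'rV[R]_n -> R) x :
  laplacian X u x = \sum_m (d m x)^-1 *
    (partial m (partial m u) x - partial m (d m) x / d m x * partial m u x
     + 2^-1 * (\sum_i partial m (d i) x / d i x) * partial m u x).
Proof.
rewrite /laplacian invmx_metric mul_diag_mx /mxtrace.
under eq_bigr do rewrite !mxE mulrBr mulr_sumr.
rewrite sumrB.
have -> : \sum_i \sum_j (d i x)^-1 * (christoffel X x j i i * partial j u x) =
    \sum_m (d m x)^-1 * (partial m (d m) x / d m x * partial m u x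
       - 2^-1 * (\sum_i partial m (d i) x / d i x) * partial m u x).
  rewrite exchange_big /=; apply: eq_bigr => m _.
  rewrite [RHS]mulrBr mulr_sumr mulr_suml mulr_sumr.
  transitivity (\sum_i ((d m x)^-1 * (partial m (d m) x / d m x * partial m u x) *+ (i == m)
      - (d m x)^-1 * (2^-1 * (partial m (d i) x / d i x) * partial m u x))).
    apply: eq_bigr => i _; rewrite christoffel_diag.
    have [->|im] := eqVneq i m; rewrite ?mulr1n ?mulr0n.
      by field; exact: d_neq0.
    by field; rewrite !d_neq0.
  rewrite sumrB (bigD1 m) //= eqxx mulr1n big1 ?addr0 // => i im.
  by rewrite (negPf im) mulr0n.
rewrite -sumrB; apply: eq_bigr => m _; ring.
Qed.

(* From here on X is a hypersurface of the unit sphere with unit normal nu at x,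
   and h is the diagonal of its second fundamental form. *)
Context {x : 'rV[R]_n} {nu : 'rV[R]_N} {h : 'I_n -> R}.
Hypothesis codim2 : N = n.+2.
Hypothesis unitX : dotv (X x) (X x) = 1.
Hypothesis tangentX : forall i, dotv (X x) (partial i X x) = 0.
Hypothesis nu_normal : is_unit_normal X x nu.
Hypothesis second_nu :
  forall i j, dotv (partial i (partial j X) x) nu = h i *+ (i == j).

(** The tangent vectors, the position vector and [nu] are orthogonal and
    nonzero, so they span the ambient space and the normal line is spanned by
    [nu]. *)
Lemma unit_normal_unique mu : is_unit_normal X x mu -> mu = nu \/ mu = - nu.
Proof.
move=> [mu1 muX muT]; have [nu1 nuX nuT] := nu_normal.
pose W : 'M[R]_(n + (1 + 1), N) := col_mx (jac X x) (col_mx (X x) nu).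
have jacE i : row i (jac X x) = partial i X x by rewrite rowK.
have jac0 (w : 'rV[R]_N) : (forall i, dotv w (partial i X x) = 0) ->
    w *m (jac X x)^T = 0.
  move=> hw; apply/rowP => i; rewrite !mxE -[RHS](hw i) -jacE.
  by apply: eq_bigr => j _; rewrite !mxE.
have sc (w w' : 'rV[R]_N) : w *m w'^T = (dotv w w')%:M.
  by rewrite [LHS]mx11_scalar -dotv_mul.
have sc0 : (0%:M : 'M[R]_1) = 0.
  by apply/matrixP => i j; rewrite !mxE mul0rn.
have T0 (w : 'rV[R]_N) : (forall i, dotv w (partial i X x) = 0) ->
    jac X x *m w^T = 0.
  by move=> hw; apply: trmx_inj; rewrite trmx_mul trmxK jac0 // trmx0.
have WW : W *m W^T = block_mx (metric X x) 0 0 1%:M.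
  have XT i : dotv (partial i X x) (X x) = 0 by rewrite dotvC.
  have nuT' i : dotv (partial i X x) nu = 0 by rewrite dotvC.
  rewrite /W tr_col_mx mul_col_row tr_col_mx mul_mx_row mul_col_mx mul_col_row.
  rewrite !sc !jac0 // !T0 // row_mx0 col_mx0 unitX nu1 nuX dotvC nuX.
  rewrite sc0 -scalar_mx_block; congr block_mx.
  apply/matrixP => i j; rewrite !mxE -(jacE i) -(jacE j).
  by apply: eq_bigr => m _; rewrite !mxE.
have Wfull : row_full W.
  have uW : W *m W^T \in unitmx.
    rewrite unitmxE WW det_ublock det1 mulr1 metric_d det_diag unitfE.
    by apply/prodf_neq0 => i _; rewrite mxE.
  have rW := mxrankM_maxl W W^T; rewrite (mxrank_unit uW) in rW.
  rewrite /row_full eqn_leq rank_leq_col (leq_trans _ rW) //.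
  by rewrite codim2 addn2.
pose c := dotv mu nu; have muE : mu = c *: nu.
  apply/eqP; rewrite -subr_eq0; apply/eqP; set delta := mu - _.
  have [B BW] := row_fullP Wfull.
  rewrite -[delta]mulmx1 -trmx1 -BW trmx_mul mulmxA.
  suff -> : delta *m W^T = 0 by rewrite mul0mx.
  rewrite /W !tr_col_mx !mul_mx_row jac0 => [|i].
    rewrite !sc /delta !dotvDl !dotvNl !dotvZl muX nuX nu1.
    by rewrite mulr1 subrr mulr0 subrr sc0 !row_mx0.
  by rewrite /delta dotvDl dotvNl dotvZl muT nuT mulr0 subrr.
have /eqP : c ^+ 2 = 1 by rewrite -mu1 muE dotvZ nu1 mulr1.
rewrite sqrf_eq1 => /orP[] /eqP cE; rewrite muE cE ?scale1r ?scaleN1r; first by left.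
by right.
Qed.

Let normalE : exists b : bool, normal X x = (-1) ^+ b *: nu.
Proof.
have : is_unit_normal X x (normal X x) by apply: (@xgetPex _ 0); exists nu.
case/unit_normal_unique => ->; first by exists false; rewrite scale1r.
by exists true; rewrite expr1 scaleN1r.
Qed.

Lemma shape_diag :
  exists b : bool, Defs.shape X x = diag_mx (\row_i ((-1) ^+ b * (h i / d i x))).
Proof.
have [b nE] := normalE; exists b.
rewrite /Defs.shape invmx_metric (_ : second_ff X x = diag_mx (\row_i ((-1) ^+ b * h i))).
  by rewrite mulmx_diag; congr diag_mx; apply/rowP => i; rewrite !mxE; ring.
apply/matrixP => i j; rewrite !mxE nE dotvZr second_nu.
by case: eqP => [->|]; rewrite ?mulr1n ?mulr0n ?mulr0.
Qed.

Lemma mean_curvature_diag :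
  (0 < n)%N -> mean_curvature X x = 0 -> \sum_i h i / d i x = 0.
Proof.
move=> n0; have [b sE] := shape_diag; rewrite /mean_curvature sE mxtrace_diag.
under eq_bigr do rewrite mxE.
rewrite -mulr_sumr => /eqP; rewrite !mulf_eq0 signr_eq0 invr_eq0 pnatr_eq0.
by rewrite (gtn_eqF n0) /= orbF => /eqP.
Qed.

(** The principal curvatures are determined, up to order, by the characteristic
    polynomial of the shape operator. *)
Lemma sqnormA_diag : sqnormA X x = \sum_i (h i / d i x) ^+ 2.
Proof.
have [b sE] := shape_diag; pose kap i := (-1) ^+ b * (h i / d i x).
have cE : char_poly (Defs.shape X x) = \prod_(i < n) ('X - (kap i)%:P).
  rewrite sE char_poly_trig ?diag_mx_is_trig //.
  by apply: eq_bigr => i _; rewrite !mxE eqxx mulr1n.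
have : char_poly (Defs.shape X x) =
    \prod_(i < n) ('X - (principal_curvatures X x 0 i)%:P).
  apply: (@xgetPex _ 0 [set kappa : 'rV[R]_n |
    char_poly (Defs.shape X x) = \prod_(i < n) ('X - (kappa 0 i)%:P)]%classic).
  by exists (\row_i kap i); rewrite /= cE; apply: eq_bigr => i _; rewrite mxE.
rewrite cE; set pc := principal_curvatures X x => pE.
have pm : perm_eq [seq kap i | i <- index_enum 'I_n] [seq pc 0 i | i <- index_enum 'I_n].
  by apply: prod_XsubC_eq; rewrite !big_map pE.
rewrite /sqnormA -/pc -(big_map (fun i => pc 0 i) xpredT (fun t => t ^+ 2)).
rewrite -(perm_big _ pm) big_map; apply: eq_bigr => i _.
by rewrite /kap exprMn sqrr_sign mul1r.
Qed.

End DiagonalMetric.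

(** * The profile curve *)

(** Take gamma = (x, y, z), gamma' = (x1, y1, z1) and S = |gamma'|. The frame
    gamma, gamma' / S, nu = gamma x gamma' / S is orthonormal, hence so are the
    columns of its matrix: the lemmas give the norm of the first column and the
    product of the first two, the others following by cyclic permutation. *)
Section Frame.
Context {F : fieldType} {x y z x1 y1 z1 S : F}.
Hypotheses (S0 : S != 0) (S2 : S ^+ 2 = x1 ^+ 2 + y1 ^+ 2 + z1 ^+ 2).
Hypotheses (u1 : x ^+ 2 + y ^+ 2 + z ^+ 2 = 1) (o1 : x * x1 + y * y1 + z * z1 = 0).

Lemma frame_sq :
  x1 ^+ 2 / S ^+ 2 = 1 - x ^+ 2 - ((y * z1 - z * y1) / S) ^+ 2.
Proof.
have zz : z * z1 = - (x * x1 + y * y1).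
  by apply/eqP; rewrite -addr_eq0 addrC o1.
have e : x1 ^+ 2 = (1 - x ^+ 2) * S ^+ 2 - (y * z1 - z * y1) ^+ 2.
  rewrite S2 -u1.
  transitivity ((y ^+ 2 + z ^+ 2) * x1 ^+ 2 + (y * y1 + z * z1) ^+ 2); last by ring.
  have -> : y * y1 + z * z1 = - (x * x1) by rewrite zz; ring.
  transitivity ((x ^+ 2 + y ^+ 2 + z ^+ 2) * x1 ^+ 2); last by ring.
  by rewrite u1 mul1r.
by rewrite e; field.
Qed.

Lemma frame_cross :
  x1 * y1 / S ^+ 2 =
  - (x * y) - (y * z1 - z * y1) / S * ((z * x1 - x * z1) / S).
Proof.
have zz : z * z1 = - (x * x1 + y * y1).
  by apply/eqP; rewrite -addr_eq0 addrC o1.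
have e : x1 * y1 =
    - (x * y) * S ^+ 2 - (y * z1 - z * y1) * (z * x1 - x * z1).
  rewrite S2.
  transitivity (z ^+ 2 * (x1 * y1) - (y * x1 + x * y1) * (z * z1)
    - x * y * (x1 ^+ 2 + y1 ^+ 2)); last by ring.
  rewrite zz; transitivity ((x ^+ 2 + y ^+ 2 + z ^+ 2) * (x1 * y1)); last by ring.
  by rewrite u1 mul1r.
by rewrite e; field.
Qed.

End Frame.

Section FrameDerivative.
Context {F : fieldType} {x y z x1 y1 z1 x2 y2 z2 S K W : F}.
Hypotheses (S0 : S != 0) (S2 : S ^+ 2 = x1 ^+ 2 + y1 ^+ 2 + z1 ^+ 2).
Hypotheses (o1 : x * x1 + y * y1 + z * z1 = 0).
Hypothesis curvK : x2 * ((y * z1 - z * y1) / S) + y2 * ((z * x1 - x * z1) / S)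
  + z2 * ((x * y1 - y * x1) / S) = K * S ^+ 2.
Hypothesis W_def : W = x1 * x2 + y1 * y2 + z1 * z2.

(** The first component of nu' = - K gamma', for nu = gamma x gamma' / S. *)
Lemma frame_nu_derive :
  (y * z2 - z * y2) / S
  - (y * z1 - z * y1) * W / S ^+ 3 = - K * x1.
Proof.
rewrite W_def.
have D : x2 * (y * z1 - z * y1) + y2 * (z * x1 - x * z1) + z2 * (x * y1 - y * x1)
    = K * S ^+ 3.
  by apply: (@mulIf _ S^-1); [rewrite invr_eq0 | rewrite -[RHS]mulrA;
     transitivity (K * S ^+ 2); [rewrite -curvK; ring | field]].
have e : S ^+ 2 * (y * z2 - z * y2)
    - (y * z1 - z * y1) * (x1 * x2 + y1 * y2 + z1 * z2) = - K * S ^+ 3 * x1.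
  rewrite mulNr -D S2.
  transitivity ((x * x1 + y * y1 + z * z1) * (y1 * z2 - z1 * y2)
     - (x2 * (y * z1 - z * y1) + y2 * (z * x1 - x * z1) + z2 * (x * y1 - y * x1)) * x1).
    by ring.
  by rewrite o1; ring.
apply: (@mulIf _ (S ^+ 3)); first by rewrite expf_neq0.
by transitivity (- K * S ^+ 3 * x1); [rewrite -e; field | ring].
Qed.

Hypotheses (u1 : x ^+ 2 + y ^+ 2 + z ^+ 2 = 1).
Hypothesis (o2 : x * x2 + y * y2 + z * z2 = - S ^+ 2).

(** The first component of gamma'', expanded in the frame. *)
Lemma frame_acceleration :
  x2 - W / S ^+ 2 * x1 = S ^+ 2 * (- x + K * ((y * z1 - z * y1) / S)).
Proof.
rewrite W_def.
set a := (y * z1 - z * y1) / S; set b := (z * x1 - x * z1) / S.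
set c := (x * y1 - y * x1) / S.
have xx : x1 ^+ 2 / S ^+ 2 = 1 - x ^+ 2 - a ^+ 2 by exact: frame_sq.
have xy : x1 * y1 / S ^+ 2 = - (x * y) - a * b by exact: frame_cross.
have zx : z1 * x1 / S ^+ 2 = - (z * x) - c * a.
  apply: (@frame_cross _ z x y z1 x1 y1 S) => //.
  - by rewrite S2; ring.
  - by rewrite -u1; ring.
  - by rewrite -o1; ring.
transitivity (x2 - (x2 * (x1 ^+ 2 / S ^+ 2) + y2 * (x1 * y1 / S ^+ 2)
  + z2 * (z1 * x1 / S ^+ 2))); first by field.
rewrite xx xy zx.
transitivity ((x * x2 + y * y2 + z * z2) * x + (x2 * a + y2 * b + z2 * c) * a).
  by ring.
by rewrite o2 curvK; ring.
Qed.

End FrameDerivative.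

(* Comparing two derivatives up to conversion, as [ring] and [field] do with
   their atoms, unfolds limits; so derivatives are replaced by variables. *)
Local Ltac abstract_derivatives :=
  repeat match goal with |- context [derive1 (derive1 ?g) ?t] =>
    move: (derive1 (derive1 g) t) => ? end;
  repeat match goal with |- context [derive1 ?g ?t] =>
    move: (derive1 g t) => ? end.

Section ProfileDefs.
Context {R : realType} (k l : nat) (f f2 f1 : R -> R).

Definition speed2 (t : R) : R :=
  derive1 f t ^+ 2 + derive1 f2 t ^+ 2 + derive1 f1 t ^+ 2.

(** The components of nu = gamma x gamma' / |gamma'| are [nu_comp f2 f1],
    [nu_comp f1 f] and [nu_comp f f2]. *)
Definition nu_comp (p q : R -> R) (t : R) : R :=
  (p t * derive1 q t - q t * derive1 p t) / Num.sqrt (speed2 t).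

Definition nu_y := nu_comp f2 f1.
Definition nu_z := nu_comp f1 f.
Definition nu_t := nu_comp f f2.

(** Minus the sum of the principal curvatures in the directions of the two
    spheres: on a minimal hypersurface, the principal curvature along the profile
    curve. *)
Definition curv (t : R) : R := k%:R * (nu_y t / f t) + l%:R * (nu_z t / f2 t).

(** The Laplacian of the hypersurface on functions of [t] alone. *)
Definition profile_laplacian (G : R -> R) (t : R) : R :=
  (speed2 t)^-1 * (derive1 (derive1 G) t
    + (k%:R * (derive1 f t / f t) + l%:R * (derive1 f2 t / f2 t)
       - derive1 speed2 t / (2 * speed2 t)) * derive1 G t).

(** The value of |A|^2 on a minimal hypersurface, by [sqnormA_chart]. *)
Definition sq_curv (t : R) : R :=
  k%:R * (nu_y t / f t) ^+ 2 + l%:R * (nu_z t / f2 t) ^+ 2 + curv t ^+ 2.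

(** The inverse of the volume density of the orbits: it solves G' = - H G, where
    H = k f' / f + l f2' / f2 is the logarithmic derivative of that density. *)
Definition inv_vol (t : R) : R := (f t)^-1 ^+ k * (f2 t)^-1 ^+ l.

End ProfileDefs.

Section Profile.
Context {R : realType} {k l : nat} {f f2 f1 : R -> R}.
Local Notation E := (speed2 f f2 f1).
Local Notation nu_comp := (nu_comp f f2 f1).
Local Notation nu_y := (nu_y f f2 f1).
Local Notation nu_z := (nu_z f f2 f1).
Local Notation nu_t := (nu_t f f2 f1).
Local Notation curv := (curv k l f f2 f1).
Local Notation sq_curv := (sq_curv k l f f2 f1).
Local Notation profile_laplacian := (profile_laplacian k l f f2 f1).
Local Notation inv_vol := (inv_vol k l f f2).

Hypotheses (sf : smooth1 f) (sf2 : smooth1 f2) (sf1 : smooth1 f1).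
Hypotheses (f_gt0 : forall t, 0 < f t) (f2_gt0 : forall t, 0 < f2 t).
Hypothesis unit_curve : forall t, f t ^+ 2 + f2 t ^+ 2 + f1 t ^+ 2 = 1.
Hypothesis speed2_gt0 : forall t, 0 < E t.

Let S (t : R) : R := Num.sqrt (E t).

Let S0 t : S t != 0.
Proof. by rewrite gt_eqF // sqrtr_gt0. Qed.

Let S2 t : S t ^+ 2 = E t.
Proof. by rewrite sqr_sqrtr // ltW. Qed.

Let d1 (g : R -> R) (t : R) : smooth1 g -> is_derive t 1 g (derive1 g t).
Proof. exact: smooth1_is_derive. Qed.

Let d2 (g : R -> R) (t : R) :
  smooth1 g -> is_derive t 1 (derive1 g) (derive1 (derive1 g) t).
Proof. by move=> sg; apply/smooth1_is_derive/smooth1_derive1. Qed.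

Let derive1_val (g : R -> R) (t a : R) : is_derive t 1 g a -> derive1 g t = a.
Proof. by move=> h; rewrite derive1E derive_val. Qed.

Lemma speed2_smooth : smooth1 E.
Proof.
apply: smooth1_alg; apply: gen_add; last exact/gen_exp/gen_base/smooth1_derive1.
by apply: gen_add; exact/gen_exp/gen_base/smooth1_derive1.
Qed.

Lemma nu_comp_smooth p q : smooth1 p -> smooth1 q -> smooth1 (nu_comp p q).
Proof.
move=> sp sq; apply: smooth1_alg; apply: gen_mul.
  by apply: gen_sub; apply: gen_mul; apply: gen_base;
    [exact: sp | exact: smooth1_derive1 | exact: sq | exact: smooth1_derive1].
by apply/gen_base/smooth1_inv => [t|]; [exact: S0 | exact: smooth1_sqrt speed2_smooth _].
Qed.

Let W (t : R) : R := derive1 f t * derive1 (derive1 f) t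
  + derive1 f2 t * derive1 (derive1 f2) t + derive1 f1 t * derive1 (derive1 f1) t.

Let dE (t : R) : is_derive t 1 E (2 * W t).
Proof.
have h := is_derive_addf (is_derive_addf (is_derive_expf 2 (d2 t sf))
  (is_derive_expf 2 (d2 t sf2))) (is_derive_expf 2 (d2 t sf1)).
by apply: is_derive_eq h _; rewrite /W /=; abstract_derivatives; ring.
Qed.

Let dS (t : R) : is_derive t 1 S (W t / S t).
Proof.
have h := @is_derive1_comp R Num.sqrt E t _ _ (is_derive1_sqrt (speed2_gt0 t)) (dE t).
apply: is_derive_eq h _; rewrite -/(S t); abstract_derivatives; field; exact: S0.
Qed.

Lemma profile_orth t :
  f t * derive1 f t + f2 t * derive1 f2 t + f1 t * derive1 f1 t = 0.
Proof.
have h := is_derive_addf (is_derive_addf (is_derive_expf 2 (d1 t sf))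
  (is_derive_expf 2 (d1 t sf2))) (is_derive_expf 2 (d1 t sf1)).
have e : (fun t => f t ^+ 2 + f2 t ^+ 2 + f1 t ^+ 2) = cst 1.
  by apply/funext => s; rewrite unit_curve.
rewrite e in h; have := @derive_val _ _ _ _ _ _ _ h.
rewrite derive_cst => /esym h0; apply: (@mulfI _ 2); first by rewrite pnatr_eq0.
by rewrite mulr0 -[RHS]h0 /=; abstract_derivatives; ring.
Qed.

Let orth2 t : f t * derive1 (derive1 f) t + f2 t * derive1 (derive1 f2) t
  + f1 t * derive1 (derive1 f1) t = - S t ^+ 2.
Proof.
have h := is_derive_addf (is_derive_addf (is_derive_mulf (d1 t sf) (d2 t sf))
  (is_derive_mulf (d1 t sf2) (d2 t sf2))) (is_derive_mulf (d1 t sf1) (d2 t sf1)).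
have e : (fun t => f t * derive1 f t + f2 t * derive1 f2 t + f1 t * derive1 f1 t) = cst 0.
  by apply/funext => s; rewrite profile_orth.
rewrite e in h; have := @derive_val _ _ _ _ _ _ _ h.
rewrite derive_cst => h0; apply/eqP; rewrite -addr_eq0 S2 [X in _ == X]h0; apply/eqP.
by rewrite /E /speed2; abstract_derivatives; ring.
Qed.

Let d_nu_comp p q (t : R) : smooth1 p -> smooth1 q ->
  is_derive t 1 (nu_comp p q)
    ((p t * derive1 (derive1 q) t - q t * derive1 (derive1 p) t) / S t
     - (p t * derive1 q t - q t * derive1 p t) * W t / S t ^+ 3).
Proof.
move=> sp sq; have h := is_derive_mulf (is_derive_addf
  (is_derive_mulf (d1 t sp) (d2 t sq)) (is_derive_oppf (is_derive_mulf (d1 t sq) (d2 t sp))))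
  (is_derive_invf (S0 t) (dS t)).
by apply: is_derive_eq h _; abstract_derivatives; field; exact: S0.
Qed.

Hypothesis minimal_curve : forall t,
  derive1 (derive1 f) t * nu_y t + derive1 (derive1 f2) t * nu_z t
  + derive1 (derive1 f1) t * nu_t t = curv t * E t.

Let curv_S t : derive1 (derive1 f) t * nu_y t + derive1 (derive1 f2) t * nu_z t
  + derive1 (derive1 f1) t * nu_t t = curv t * S t ^+ 2.
Proof. by rewrite S2 minimal_curve. Qed.

Let S2E t : S t ^+ 2 = derive1 f t ^+ 2 + derive1 f2 t ^+ 2 + derive1 f1 t ^+ 2.
Proof. exact: S2. Qed.

(** The shape operator acts on the profile curve by [curv]. *)
Lemma d_nu_y (t : R) : is_derive t 1 nu_y (- curv t * derive1 f t).
Proof.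
apply: is_derive_eq (d_nu_comp t sf2 sf1) _.
exact: (frame_nu_derive (S0 t) (S2E t) (profile_orth t) (curv_S t) (erefl (W t))).
Qed.

(* Cyclic permutations of (f, f2, f1) reduce the statements on the second and
   third components to those on the first one. *)
Let cyc (F : zmodType) (a b c : F) : b + c + a = a + b + c.
Proof. by rewrite addrC addrA. Qed.

Lemma d_nu_z (t : R) : is_derive t 1 nu_z (- curv t * derive1 f2 t).
Proof.
apply: is_derive_eq (d_nu_comp t sf1 sf) _.
have e := S2E t; rewrite -cyc in e; have o := profile_orth t; rewrite -cyc in o.
have c := curv_S t; rewrite -cyc in c.
apply: (frame_nu_derive (S0 t) e o c).
by rewrite cyc.
Qed.

Lemma d_nu_t (t : R) : is_derive t 1 nu_t (- curv t * derive1 f1 t).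
Proof.
apply: is_derive_eq (d_nu_comp t sf sf2) _.
have e := S2E t; rewrite cyc in e; have o := profile_orth t; rewrite cyc in o.
have c := curv_S t; rewrite cyc in c.
apply: (frame_nu_derive (S0 t) e o c).
by rewrite -cyc.
Qed.

Let f0 t : f t != 0. Proof. by rewrite gt_eqF. Qed.
Let f20 t : f2 t != 0. Proof. by rewrite gt_eqF. Qed.
Let E0 t : E t != 0. Proof. by rewrite gt_eqF. Qed.

Let col_yy t : derive1 f t ^+ 2 / E t = 1 - f t ^+ 2 - nu_y t ^+ 2.
Proof. by rewrite -S2; exact: (frame_sq (S0 t) (S2E t) (unit_curve t) (profile_orth t)). Qed.

Let col_yz t : derive1 f t * derive1 f2 t / E t = - (f t * f2 t) - nu_y t * nu_z t.
Proof. by rewrite -S2; exact: (frame_cross (S0 t) (S2E t) (unit_curve t) (profile_orth t)). Qed.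

Let rot t : [/\ S t ^+ 2 = derive1 f2 t ^+ 2 + derive1 f1 t ^+ 2 + derive1 f t ^+ 2,
  f2 t ^+ 2 + f1 t ^+ 2 + f t ^+ 2 = 1
  & f2 t * derive1 f2 t + f1 t * derive1 f1 t + f t * derive1 f t = 0].
Proof. by split; rewrite cyc; [exact: S2E | exact: unit_curve | exact: profile_orth]. Qed.

Let rot2 t : [/\ S t ^+ 2 = derive1 f1 t ^+ 2 + derive1 f t ^+ 2 + derive1 f2 t ^+ 2,
  f1 t ^+ 2 + f t ^+ 2 + f2 t ^+ 2 = 1
  & f1 t * derive1 f1 t + f t * derive1 f t + f2 t * derive1 f2 t = 0].
Proof. by have [h1 h2 h3] := rot t; split; rewrite cyc. Qed.

Let col_zz t : derive1 f2 t ^+ 2 / E t = 1 - f2 t ^+ 2 - nu_z t ^+ 2.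
Proof. by rewrite -S2; have [h1 h2 h3] := rot t; exact: (frame_sq (S0 t) h1 h2 h3). Qed.

Let col_tt t : derive1 f1 t ^+ 2 / E t = 1 - f1 t ^+ 2 - nu_t t ^+ 2.
Proof. by rewrite -S2; have [h1 h2 h3] := rot2 t; exact: (frame_sq (S0 t) h1 h2 h3). Qed.

Let col_zt t : derive1 f2 t * derive1 f1 t / E t = - (f2 t * f1 t) - nu_z t * nu_t t.
Proof. by rewrite -S2; have [h1 h2 h3] := rot t; exact: (frame_cross (S0 t) h1 h2 h3). Qed.

Let col_ty t : derive1 f1 t * derive1 f t / E t = - (f1 t * f t) - nu_t t * nu_y t.
Proof. by rewrite -S2; have [h1 h2 h3] := rot2 t; exact: (frame_cross (S0 t) h1 h2 h3). Qed.

Let acc_y t : derive1 (derive1 f) t - W t / E t * derive1 f t =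
  E t * (- f t + curv t * nu_y t).
Proof.
rewrite -S2; exact: (frame_acceleration (S0 t) (S2E t) (profile_orth t) (curv_S t)
  (erefl (W t)) (unit_curve t) (orth2 t)).
Qed.

Let acc_z t : derive1 (derive1 f2) t - W t / E t * derive1 f2 t =
  E t * (- f2 t + curv t * nu_z t).
Proof.
rewrite -S2; have [h1 h2 h3] := rot t.
have h4 := curv_S t; rewrite -cyc in h4; have h5 := orth2 t; rewrite -cyc in h5.
by apply: (frame_acceleration (S0 t) h1 h3 h4 _ h2 h5); rewrite cyc.
Qed.

Let acc_t t : derive1 (derive1 f1) t - W t / E t * derive1 f1 t =
  E t * (- f1 t + curv t * nu_t t).
Proof.
rewrite -S2; have [h1 h2 h3] := rot2 t.
have h4 := curv_S t; rewrite cyc in h4; have h5 := orth2 t; rewrite cyc in h5.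
by apply: (frame_acceleration (S0 t) h1 h3 h4 _ h2 h5); rewrite -cyc.
Qed.

Let log_d (c : R) (p q : R -> R) (t a b : R) : q t != 0 ->
  is_derive t 1 p a -> is_derive t 1 q b ->
  is_derive t 1 (fun t => c * (p t / q t)) (c * (a / q t - p t * b / q t ^+ 2)).
Proof.
move=> q0 hp hq; have h := is_derive_mulf (is_derive_cstf c t 1)
  (is_derive_mulf hp (is_derive_invf q0 hq)).
by apply: is_derive_eq h _; field.
Qed.

Let d_curv (t : R) : is_derive t 1 curv
  (k%:R * (- curv t * derive1 f t / f t - nu_y t * derive1 f t / f t ^+ 2)
   + l%:R * (- curv t * derive1 f2 t / f2 t - nu_z t * derive1 f2 t / f2 t ^+ 2)).
Proof.
apply: is_derive_addf.
  by apply: log_d; [exact: f0 | exact: d_nu_y | exact: d1].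
by apply: log_d; [exact: f20 | exact: d_nu_z | exact: d1].
Qed.

(* In curv' + H curv the terms in nu_y' and nu_z' cancel H curv, which leaves
   - (k nu_y f' / f^2 + l nu_z f2' / f2^2): third derivatives of the curve never
   occur. *)
Let profile_laplacian_nu (p nu : R -> R) t : smooth1 p ->
  (forall t : R, is_derive t 1 nu (- curv t * derive1 p t)) ->
  derive1 (derive1 p) t - W t / E t * derive1 p t = E t * (- p t + curv t * nu t) ->
  profile_laplacian nu t =
  k%:R * (nu_y t / f t ^+ 2) * (derive1 f t * derive1 p t / E t)
  + l%:R * (nu_z t / f2 t ^+ 2) * (derive1 f2 t * derive1 p t / E t)
  + curv t * p t - curv t ^+ 2 * nu t.
Proof.
move=> sp dnu acc.
have e1 : derive1 nu = fun t => - curv t * derive1 p t.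
  by apply/funext => s; exact: derive1_val.
have e2 := derive1_val (is_derive_mulf (is_derive_oppf (d_curv t)) (d2 t sp)).
rewrite /profile_laplacian (derive1_val (dE t)) e1 e2.
have {}acc : derive1 (derive1 p) t =
    W t / E t * derive1 p t + E t * (- p t + curv t * nu t).
  by rewrite -acc; ring.
rewrite acc; have := f0 t; have := f20 t; have := E0 t.
move: (W t) (curv t) (E t) (nu_y t) (nu_z t) (nu t) (f t) (f2 t) (p t).
move: (derive1 f t) (derive1 f2 t) (derive1 p t).
by move=> *; field; do ?[apply/andP; split].
Qed.

Lemma profile_laplacian_nu_y t :
  profile_laplacian nu_y t - k%:R / f t ^+ 2 * nu_y t = - sq_curv t * nu_y t.
Proof.
rewrite (profile_laplacian_nu sf d_nu_y (acc_y t)) -expr2 col_yy.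
rewrite (mulrC (derive1 f2 t)) col_yz /sq_curv.
have -> : curv t * f t = k%:R * nu_y t + l%:R * (nu_z t / f2 t) * f t.
  by rewrite /curv; field; rewrite f0 f20.
move: (curv t) (nu_y t) (nu_z t) (f t) (f2 t) (f0 t) (f20 t) => *.
by field; do ?[apply/andP; split].
Qed.

Lemma profile_laplacian_nu_z t :
  profile_laplacian nu_z t - l%:R / f2 t ^+ 2 * nu_z t = - sq_curv t * nu_z t.
Proof.
rewrite (profile_laplacian_nu sf2 d_nu_z (acc_z t)) col_yz -expr2 col_zz /sq_curv.
have -> : curv t * f2 t = k%:R * (nu_y t / f t) * f2 t + l%:R * nu_z t.
  by rewrite /curv; field; rewrite f0 f20.
move: (curv t) (nu_y t) (nu_z t) (f t) (f2 t) (f0 t) (f20 t) => *.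
by field; do ?[apply/andP; split].
Qed.

Lemma profile_laplacian_nu_t t :
  profile_laplacian nu_t t = - sq_curv t * nu_t t.
Proof.
rewrite (profile_laplacian_nu sf1 d_nu_t (acc_t t)) col_zt.
rewrite (mulrC (derive1 f t)) col_ty /sq_curv.
have -> : curv t * f1 t = k%:R * (nu_y t / f t) * f1 t + l%:R * (nu_z t / f2 t) * f1 t.
  by rewrite /curv; ring.
move: (curv t) (nu_y t) (nu_z t) (nu_t t) (f t) (f2 t) (f1 t) (f0 t) (f20 t) => *.
by field; do ?[apply/andP; split].
Qed.

Let H t := k%:R * (derive1 f t / f t) + l%:R * (derive1 f2 t / f2 t).

Let dH (t : R) : is_derive t 1 H
  (k%:R * (derive1 (derive1 f) t / f t - derive1 f t * derive1 f t / f t ^+ 2)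
   + l%:R * (derive1 (derive1 f2) t / f2 t - derive1 f2 t * derive1 f2 t / f2 t ^+ 2)).
Proof.
by apply: is_derive_addf; apply: log_d;
  [exact: f0 | exact: d2 | exact: d1 | exact: f20 | exact: d2 | exact: d1].
Qed.

Let d_inv_exp (m : nat) (p : R -> R) (t a : R) : p t != 0 -> is_derive t 1 p a ->
  is_derive t 1 (fun t => (p t)^-1 ^+ m) (- m%:R * (a / p t) * (p t)^-1 ^+ m).
Proof.
move=> p0 hp; apply: is_derive_eq (is_derive_expf m (is_derive_invf p0 hp)) _.
case: m => [|m]; first by rewrite !mul0r oppr0 !mul0r.
by rewrite /= [in RHS]exprS; move: ((p t)^-1 ^+ m) => ?; field.
Qed.

Lemma d_inv_vol (t : R) : is_derive t 1 inv_vol (- H t * inv_vol t).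
Proof.
apply: is_derive_eq (is_derive_mulf (d_inv_exp k (f0 t) (d1 t sf))
  (d_inv_exp l (f20 t) (d1 t sf2))) _.
by rewrite /H /inv_vol; ring.
Qed.

(** Since G' = - H G, the equation says
    H' - (E' / 2 E) H = E (|A|^2 - k / f^2 - l / f2^2), which results from the
    expansions of f'' and f2'' in the frame. *)
Lemma profile_laplacian_inv_vol t :
  profile_laplacian inv_vol t
  - (k%:R / f t ^+ 2 + l%:R / f2 t ^+ 2) * inv_vol t = - sq_curv t * inv_vol t.
Proof.
have e1 : derive1 inv_vol = fun t => - H t * inv_vol t.
  by apply/funext => s; exact/derive1_val/d_inv_vol.
have e2 := derive1_val (is_derive_mulf (is_derive_oppf (dH t)) (d_inv_vol t)).
rewrite /profile_laplacian (derive1_val (dE t)) e1 e2 -/(H t).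
have ay : derive1 (derive1 f) t =
    W t / E t * derive1 f t + E t * (- f t + curv t * nu_y t).
  by rewrite -acc_y; ring.
have az : derive1 (derive1 f2) t =
    W t / E t * derive1 f2 t + E t * (- f2 t + curv t * nu_z t).
  by rewrite -acc_z; ring.
have yy : derive1 f t * derive1 f t = E t * (1 - f t ^+ 2 - nu_y t ^+ 2).
  by rewrite -col_yy; field; exact: E0.
have zz : derive1 f2 t * derive1 f2 t = E t * (1 - f2 t ^+ 2 - nu_z t ^+ 2).
  by rewrite -col_zz; field; exact: E0.
rewrite ay az yy zz.
transitivity ((- (k%:R * (- 1 - (1 - f t ^+ 2 - nu_y t ^+ 2) / f t ^+ 2)
    + l%:R * (- 1 - (1 - f2 t ^+ 2 - nu_z t ^+ 2) / f2 t ^+ 2))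
    - curv t * (k%:R * (nu_y t / f t) + l%:R * (nu_z t / f2 t))
    - (k%:R / f t ^+ 2 + l%:R / f2 t ^+ 2)) * inv_vol t).
  rewrite /H.
  have := f0 t; have := f20 t; have := E0 t.
  move: (W t) (curv t) (E t) (nu_y t) (nu_z t) (inv_vol t) (f t) (f2 t).
  move: (derive1 f t) (derive1 f2 t).
  by move=> *; field; do ?[apply/andP; split].
rewrite -/(curv t) /sq_curv.
move: (curv t) (inv_vol t) (nu_y t) (nu_z t) (f t) (f2 t) (f0 t) (f20 t) => *.
by field; do ?[apply/andP; split].
Qed.

Lemma nu_unit t : nu_y t ^+ 2 + nu_z t ^+ 2 + nu_t t ^+ 2 = 1.
Proof.
have h : derive1 f t ^+ 2 / E t + derive1 f2 t ^+ 2 / E t + derive1 f1 t ^+ 2 / E t = 1.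
  by rewrite -!mulrDl -[X in X / _]/(E t) mulfV.
move: h; rewrite col_yy col_zz col_tt => h.
by have u := unit_curve t; lra.
Qed.

Lemma nu_orth t : nu_y t * f t + nu_z t * f2 t + nu_t t * f1 t = 0.
Proof. by rewrite /nu_y /nu_z /nu_t /nu_comp; abstract_derivatives; ring. Qed.

Lemma nu_orth_d t :
  nu_y t * derive1 f t + nu_z t * derive1 f2 t + nu_t t * derive1 f1 t = 0.
Proof. by rewrite /nu_y /nu_z /nu_t /nu_comp; abstract_derivatives; ring. Qed.

Lemma inv_vol_smooth : smooth1 inv_vol.
Proof.
by apply: smooth1_alg; apply: gen_mul; apply/gen_exp/gen_base/smooth1_inv.
Qed.

Lemma inv_vol_gt0 t : 0 < inv_vol t.
Proof. by rewrite mulr_gt0 // exprn_gt0 // invr_gt0. Qed.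

(** Where f' = 0, the column of the frame formed by f, f' and nu_y gives
    nu_y^2 = 1 - f^2, which is positive since f2 > 0. *)
Lemma nu_y_neq0 t : derive1 f t = 0 -> nu_y t != 0.
Proof.
move=> h; have := col_yy t; rewrite h -(unit_curve t) => e.
apply/eqP => n0; move: e; rewrite n0 expr0n /= mul0r => e.
by have := exprn_gt0 2 (f2_gt0 t); have := sqr_ge0 (f1 t); lra.
Qed.

Lemma nu_z_neq0 t : derive1 f2 t = 0 -> nu_z t != 0.
Proof.
move=> h; have := col_zz t; rewrite h -(unit_curve t) => e.
apply/eqP => n0; move: e; rewrite n0 expr0n /= mul0r => e.
by have := exprn_gt0 2 (f_gt0 t); have := sqr_ge0 (f1 t); lra.
Qed.

Lemma nu_t_neq0 t : derive1 f1 t = 0 -> nu_t t != 0.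
Proof.
move=> h; have := col_tt t; rewrite h -(unit_curve t) => e.
apply/eqP => n0; move: e; rewrite n0 expr0n /= mul0r => e.
by have := exprn_gt0 2 (f_gt0 t); have := sqr_ge0 (f2 t); lra.
Qed.

End Profile.

(** * The hypersurface in a chart *)

(** A family indexed by the coordinates of the product, constant on each of the
    blocks y, z and t. *)
Definition by_block (A : Type) (k l : nat) (ay az at_ : A) (m : 'I_(k + l + 1)) : A :=
  match fintype.split m with
  | inl m' => if fintype.split m' then ay else az
  | inr _ => at_
  end.

Lemma by_blockE (A : Type) (k l : nat) (ay az at_ : A) :
  (forall i : 'I_k, by_block ay az at_ (idx_y i : 'I_(k + l + 1)) = ay) *
  (forall j : 'I_l, by_block ay az at_ (idx_z j : 'I_(k + l + 1)) = az) *
  (by_block ay az at_ (idx_t : 'I_(k + l + 1)) = at_).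
Proof.
rewrite /by_block; do 2?split.
- by move=> i; rewrite (unsplitK (inl (lshift l i))) (unsplitK (inl i)).
- by move=> j; rewrite (unsplitK (inl (rshift k j))) (unsplitK (inr j)).
- by rewrite (unsplitK (inr ord0)).
Qed.

Definition hyp_chart (R : realType) (k l : nat) (f f2 f1 : R -> R)
    (b : bool * bool) : 'rV[R]_(k + l + 1) -> 'rV[R]_((1 + k) + (1 + l) + 1) :=
  vsep f (stereo_vec b.1) f2 (stereo_vec b.2) f1.

Definition metric_coef (R : realType) (k l : nat) (f f2 f1 : R -> R) :
    'I_(k + l + 1) -> 'rV[R]_(k + l + 1) -> R :=
  by_block (sep (fun v => rho v ^+ 2) (fun=> 1) (fun t => f t ^+ 2))
           (sep (fun=> 1) (fun w => rho w ^+ 2) (fun t => f2 t ^+ 2))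
           (sep (fun=> 1) (fun=> 1) (speed2 f f2 f1)).

Section Chart.
Context {R : realType} {k l : nat} {f f2 f1 : R -> R}.
Hypotheses (sf : smooth1 f) (sf2 : smooth1 f2) (sf1 : smooth1 f1).
Hypotheses (f_gt0 : forall t, 0 < f t) (f2_gt0 : forall t, 0 < f2 t).
Hypothesis unit_curve : forall t, f t ^+ 2 + f2 t ^+ 2 + f1 t ^+ 2 = 1.


Context (b : bool * bool).

Let X := @hyp_chart R k l f f2 f1 b.
Local Notation metric_coef := (@metric_coef R k l f f2 f1).
Let E := speed2 f f2 f1.
Let nuy := nu_y f f2 f1.
Let nuz := nu_z f f2 f1.
Let nut := nu_t f f2 f1.

Let dg (g : R -> R) : smooth1 g -> forall t, derivable g t 1.
Proof. by move=> sg; exact: (sg 0%N). Qed.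

Let dstereo (n : nat) c (i : 'I_n) (v : 'rV[R]_n) :
  is_derive v (delta_mx 0 i) (stereo_vec c) (stereo_d c (delta_mx 0 i) v).
Proof. exact: is_derive_stereo_vec. Qed.

Let ddstereo (n : nat) c (i j : 'I_n) (v : 'rV[R]_n) :
  is_derive v (delta_mx 0 i) (stereo_d c (delta_mx 0 j))
    ('D_(delta_mx 0 i) (stereo_d c (delta_mx 0 j)) v).
Proof. by apply: derivableP; exact: derivable_stereo_d. Qed.

Let partial_y i : partial (idx_y i) X =
  vsep f (stereo_d b.1 (delta_mx 0 i)) (fun=> 0) (stereo_vec b.2) (fun=> 0).
Proof. exact: partial_vsep_y. Qed.

Let partial_z j : partial (idx_z j) X =
  vsep (fun=> 0) (stereo_vec b.1) f2 (stereo_d b.2 (delta_mx 0 j)) (fun=> 0).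
Proof. exact: partial_vsep_z. Qed.

Let partial_t : partial idx_t X =
  vsep (derive1 f) (stereo_vec b.1) (derive1 f2) (stereo_vec b.2) (derive1 f1).
Proof. by apply: partial_vsep_t; exact: dg. Qed.

Let dot_d0 (n : nat) c (w v : 'rV[R]_n) : dotv (stereo_d c w v) (stereo_vec c v) = 0.
Proof. by rewrite dotvC dotv_stereo_vec_d. Qed.

Let dot_delta (n : nat) (i j : 'I_n) :
  dotv (delta_mx 0 i : 'rV[R]_n) (delta_mx 0 j) = (i == j)%:R.
Proof. by rewrite dotv_delta mxE eqxx. Qed.

Lemma metric_chart x : metric X x = diag_mx (\row_m metric_coef m x).
Proof.
apply/matrixP => m m'; rewrite !mxE /metric_coef.
elim/(@idxP k l): m => [i|i|]; elim/(@idxP k l): m' => [j|j|];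
  rewrite ?partial_y ?partial_z ?partial_t !by_blockE dotv_vsep.
- rewrite dotv_stereo_d dot_delta /idx_y !eq_lshift /sep.
  by case: eqP => _; rewrite ?mulr1n ?mulr0n; ring.
- by rewrite /idx_y /idx_z eq_lshift eq_lrshift mulr0n; ring.
- by rewrite /idx_y /idx_t eq_lrshift mulr0n dot_d0; ring.
- by rewrite /idx_y /idx_z eq_lshift eq_rlshift mulr0n; ring.
- rewrite dotv_stereo_d dot_delta /idx_z !eq_lshift eq_rshift /sep.
  by case: eqP => _; rewrite ?mulr1n ?mulr0n; ring.
- by rewrite /idx_z /idx_t eq_lrshift mulr0n dot_d0; ring.
- by rewrite /idx_y /idx_t eq_rlshift mulr0n dotv_stereo_vec_d; ring.
- by rewrite /idx_z /idx_t eq_rlshift mulr0n dotv_stereo_vec_d; ring.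
- by rewrite eqxx mulr1n !dotv_stereo_vec /sep /E /speed2; abstract_derivatives; ring.
Qed.

Hypothesis speed2_gt0 : forall t, 0 < E t.

Lemma metric_coef_neq0 m x : metric_coef m x != 0.
Proof.
rewrite /metric_coef; elim/(@idxP k l): m => [i|i|]; rewrite !by_blockE /sep ?mulr1 ?mul1r.
- by rewrite mulf_neq0 // expf_neq0 // gt_eqF // rho_gt0.
- by rewrite mulf_neq0 // expf_neq0 // gt_eqF // rho_gt0.
- by rewrite gt_eqF.
Qed.

Let nu : 'rV[R]_(k + l + 1) -> 'rV[R]_((1 + k) + (1 + l) + 1) :=
  vsep nuy (stereo_vec b.1) nuz (stereo_vec b.2) nut.

Let tangent_ortho m x : dotv (X x) (partial m X x) = 0.
Proof.
elim/(@idxP k l): m => [i|i|];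
  rewrite ?partial_y ?partial_z ?partial_t /X /hyp_chart dotv_vsep.
- by rewrite dotv_stereo_vec_d; ring.
- by rewrite dotv_stereo_vec_d; ring.
- rewrite !dotv_stereo_vec !mulr1.
  exact: (profile_orth sf sf2 sf1 unit_curve).
Qed.

Lemma unit_normal_chart x : is_unit_normal X x (nu x).
Proof.
split=> [||m].
- rewrite dotv_vsep !dotv_stereo_vec !mulr1 -!expr2; exact: nu_unit.
- by rewrite dotv_vsep !dotv_stereo_vec !mulr1; exact: nu_orth.
- elim/(@idxP k l): m => [i|i|]; rewrite ?partial_y ?partial_z ?partial_t dotv_vsep.
  + by rewrite dotv_stereo_vec_d; ring.
  + by rewrite dotv_stereo_vec_d; ring.
  + by rewrite !dotv_stereo_vec !mulr1; exact: nu_orth_d.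
Qed.

Definition second_coef (x : 'rV[R]_(k + l + 1)) : 'I_(k + l + 1) -> R :=
  by_block (- (f (coord_t x) * nuy (coord_t x) * rho (coord_y x) ^+ 2))
           (- (f2 (coord_t x) * nuz (coord_t x) * rho (coord_z x) ^+ 2))
           (derive1 (derive1 f) (coord_t x) * nuy (coord_t x)
            + derive1 (derive1 f2) (coord_t x) * nuz (coord_t x)
            + derive1 (derive1 f1) (coord_t x) * nut (coord_t x)).

Let d0 (t : R) : derivable (fun _ : R => 0 : R) t 1.
Proof. exact: derivable_cst. Qed.

Let derive10 t : derive1 (fun _ : R => 0 : R) t = 0.
Proof. by rewrite derive1E derive_cst. Qed.

Lemma second_form_chart x m m' :
  dotv (partial m (partial m' X) x) (nu x) = second_coef x m *+ (m == m').
Proof.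
have ds (g : R -> R) : smooth1 g -> smooth1 (derive1 g) by exact: smooth1_derive1.
have dd := dotv_stereo_vec_dd.
rewrite /second_coef.
elim/(@idxP k l): m => [i|i|]; elim/(@idxP k l): m' => [j|j|];
  rewrite ?partial_y ?partial_z ?partial_t by_blockE.
- rewrite (partial_vsep_y _ _ _ _ (ddstereo b.1 i j)) dotv_vsep (dotvC _ (stereo_vec b.1 _)).
  rewrite dd dot_delta /idx_y !eq_lshift.
  by case: eqP => _; rewrite ?mulr1n ?mulr0n; ring.
- rewrite (partial_vsep_y _ _ _ _ (dstereo b.1 i)) dotv_vsep dot_d0.
  by rewrite /idx_y /idx_z eq_lshift eq_lrshift mulr0n; ring.
- rewrite (partial_vsep_y _ _ _ _ (dstereo b.1 i)) dotv_vsep dot_d0.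
  by rewrite /idx_y /idx_t eq_lrshift mulr0n; ring.
- rewrite (partial_vsep_z _ _ _ _ (dstereo b.2 i)) dotv_vsep dot_d0.
  by rewrite /idx_y /idx_z eq_lshift eq_rlshift mulr0n; ring.
- rewrite (partial_vsep_z _ _ _ _ (ddstereo b.2 i j)) dotv_vsep (dotvC _ (stereo_vec b.2 _)).
  rewrite dd dot_delta /idx_z !eq_lshift eq_rshift.
  by case: eqP => _; rewrite ?mulr1n ?mulr0n; ring.
- rewrite (partial_vsep_z _ _ _ _ (dstereo b.2 i)) dotv_vsep dot_d0.
  by rewrite /idx_z /idx_t eq_lrshift mulr0n; ring.
- rewrite (partial_vsep_t _ _ (dg sf) d0 d0) dotv_vsep dot_d0 derive10.
  by rewrite /idx_y /idx_t eq_rlshift mulr0n; ring.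
- rewrite (partial_vsep_t _ _ d0 (dg sf2) d0) dotv_vsep dot_d0 derive10.
  by rewrite /idx_z /idx_t eq_rlshift mulr0n; ring.
- rewrite (partial_vsep_t _ _ (dg (ds _ sf)) (dg (ds _ sf2)) (dg (ds _ sf1))) dotv_vsep.
  by rewrite !dotv_stereo_vec eqxx mulr1n !mulr1.
Qed.

Let codim : ((1 + k) + (1 + l) + 1 = (k + l + 1).+2)%N.
Proof. by rewrite addnACA -addnA. Qed.

Let unitX x : dotv (X x) (X x) = 1.
Proof.
by rewrite dotv_vsep !dotv_stereo_vec !mulr1 -!expr2; exact: unit_curve.
Qed.

Let ratio_y x i : second_coef x (idx_y i) / metric_coef (idx_y i) x =
  - (nuy (coord_t x) / f (coord_t x)).
Proof.
rewrite /second_coef /metric_coef !by_blockE /sep.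
have := gt_eqF (rho_gt0 (coord_y x)); have := gt_eqF (f_gt0 (coord_t x)).
move: (rho _) (f _) (nuy _) => r p q /negbT p0 /negbT r0.
by field; rewrite p0 r0.
Qed.

Let ratio_z x j : second_coef x (idx_z j) / metric_coef (idx_z j) x =
  - (nuz (coord_t x) / f2 (coord_t x)).
Proof.
rewrite /second_coef /metric_coef !by_blockE /sep.
have := gt_eqF (rho_gt0 (coord_z x)); have := gt_eqF (f2_gt0 (coord_t x)).
move: (rho _) (f2 _) (nuz _) => r p q /negbT p0 /negbT r0.
by field; rewrite p0 r0.
Qed.

Let ratio_t x : second_coef x idx_t / metric_coef idx_t x =
  (derive1 (derive1 f) (coord_t x) * nuy (coord_t x)
   + derive1 (derive1 f2) (coord_t x) * nuz (coord_t x)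
   + derive1 (derive1 f1) (coord_t x) * nut (coord_t x)) / E (coord_t x).
Proof. by rewrite /second_coef /metric_coef !by_blockE /sep !mul1r. Qed.

(** The trace of the shape operator vanishes: the principal curvatures are
    - nu_y / f (k times), - nu_z / f2 (l times) and the one of the curve. *)
Lemma minimal_chart : (forall x, mean_curvature X x = 0) ->
  forall t, derive1 (derive1 f) t * nuy t + derive1 (derive1 f2) t * nuz t
    + derive1 (derive1 f1) t * nut t = curv k l f f2 f1 t * E t.
Proof.
move=> mc t; pose x : 'rV[R]_(k + l + 1) := row_mx 0 t%:M.
have xt : coord_t x = t by rewrite /coord_t row_mxKr mxE mulr1n.
have E0 : E t != 0 by rewrite gt_eqF.
have n0 : (0 < k + l + 1)%N by rewrite addn1.
have := mean_curvature_diag metric_chart metric_coef_neq0 codim (unitX x)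
  (tangent_ortho^~ x) (unit_normal_chart x) (second_form_chart x) n0 (mc x).
rewrite sum_idx (eq_bigr _ (fun i _ => ratio_y x i)) (eq_bigr _ (fun j _ => ratio_z x j)).
rewrite ratio_t !sumr_const !card_ord -[_ *+ k]mulr_natl -[_ *+ l]mulr_natl xt => /eqP.
rewrite addrC addr_eq0 => /eqP h; apply: (@mulIf _ (E t)^-1); first by rewrite invr_eq0.
rewrite h mulfK // /curv -/nuy -/nuz.
by ring.
Qed.

Hypothesis minimal_curve : forall t,
  derive1 (derive1 f) t * nuy t + derive1 (derive1 f2) t * nuz t
  + derive1 (derive1 f1) t * nut t = curv k l f f2 f1 t * E t.

Lemma sqnormA_chart x : sqnormA X x = sq_curv k l f f2 f1 (coord_t x).
Proof.
rewrite (sqnormA_diag metric_chart metric_coef_neq0 codim (unitX x)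
  (tangent_ortho^~ x) (unit_normal_chart x) (second_form_chart x)).
have E0 t : E t != 0 by rewrite gt_eqF.
rewrite sum_idx (eq_bigr _ (fun i _ => congr1 (fun a => a ^+ 2) (ratio_y x i))).
rewrite (eq_bigr _ (fun j _ => congr1 (fun a => a ^+ 2) (ratio_z x j))).
rewrite ratio_t minimal_curve mulfK // !sumr_const !card_ord.
rewrite -[_ *+ k]mulr_natl -[_ *+ l]mulr_natl.
by rewrite /sq_curv -/nuy -/nuz !sqrrN.
Qed.

Let drho2 (n : nat) (i : 'I_n) (v : 'rV[R]_n) :
  is_derive v (delta_mx 0 i) (fun v : 'rV[R]_n => rho v ^+ 2)
    (2 * rho v * partial i (@rho R n) v).
Proof.
have h := is_derive_expf 2 (is_derive_rho v (delta_mx 0 i)).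
by apply: is_derive_eq h _; rewrite (is_derive_partial (is_derive_rho _ _)) expr1.
Qed.

Let dcst (n : nat) (i : 'I_n) (v : 'rV[R]_n) :
  is_derive v (delta_mx 0 i) (fun _ : 'rV[R]_n => 1 : R) 0.
Proof. exact: is_derive_cst. Qed.

Let dsq (g : R -> R) (t : R) : smooth1 g ->
  is_derive t 1 (fun t => g t ^+ 2) (2 * g t * derive1 g t).
Proof.
move=> sg; have h := is_derive_expf 2 (smooth1_is_derive t sg).
by apply: is_derive_eq h _; rewrite expr1.
Qed.

Let derive1_val (g : R -> R) (t a : R) : is_derive t 1 g a -> derive1 g t = a.
Proof. by move=> h; rewrite derive1E derive_val. Qed.

Let log_metric_y i x : \sum_m partial (idx_y i) (metric_coef m) x / metric_coef m x =
  k%:R * (2 * (partial i (@rho R k) (coord_y x) / rho (coord_y x))).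
Proof.
have r0 := gt_eqF (rho_gt0 (coord_y x)).
have f0 := gt_eqF (f_gt0 (coord_t x)).
rewrite sum_idx (eq_bigr (fun=> 2 * (partial i (@rho R k) (coord_y x) / rho (coord_y x)))).
  rewrite [X in _ + X + _]big1 => [|j _].
    rewrite /metric_coef by_blockE partial_sep_y => [|v]; last exact: ex_derive.
    rewrite /sep (is_derive_partial (dcst _ _)) !mul0r !addr0.
    by rewrite sumr_const card_ord -[_ *+ k]mulr_natl.
  rewrite /metric_coef by_blockE partial_sep_y => [|v]; last exact: ex_derive.
  by rewrite /sep (is_derive_partial (dcst _ _)) !mul0r.
move=> j _; rewrite /metric_coef by_blockE partial_sep_y => [|v]; last exact: ex_derive.
rewrite /sep (is_derive_partial (drho2 _ _)).
move: (rho _) (partial _ _ _) (f _) r0 f0 => r pr p /negbT r0 /negbT p0.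
by field; rewrite r0 p0.
Qed.

Let log_metric_z j x : \sum_m partial (idx_z j) (metric_coef m) x / metric_coef m x =
  l%:R * (2 * (partial j (@rho R l) (coord_z x) / rho (coord_z x))).
Proof.
have r0 := gt_eqF (rho_gt0 (coord_z x)).
have f0 := gt_eqF (f2_gt0 (coord_t x)).
rewrite sum_idx [X in _ + X + _](eq_bigr
  (fun=> 2 * (partial j (@rho R l) (coord_z x) / rho (coord_z x)))).
  rewrite [X in X + _ + _]big1 => [|i _].
    rewrite /metric_coef by_blockE partial_sep_z => [|v]; last exact: ex_derive.
    rewrite /sep (is_derive_partial (dcst _ _)) mulr0 !mul0r addr0 add0r.
    by rewrite sumr_const card_ord -[_ *+ l]mulr_natl.
  rewrite /metric_coef by_blockE partial_sep_z => [|v]; last exact: ex_derive.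
  by rewrite /sep (is_derive_partial (dcst _ _)) mulr0 !mul0r.
move=> i _; rewrite /metric_coef by_blockE partial_sep_z => [|v]; last exact: ex_derive.
rewrite /sep (is_derive_partial (drho2 _ _)).
move: (rho _) (partial _ _ _) (f2 _) r0 f0 => r pr p /negbT r0 /negbT p0.
by field; rewrite r0 p0.
Qed.

Let log_metric_t x : \sum_m partial idx_t (metric_coef m) x / metric_coef m x =
  k%:R * (2 * (derive1 f (coord_t x) / f (coord_t x)))
  + l%:R * (2 * (derive1 f2 (coord_t x) / f2 (coord_t x)))
  + derive1 E (coord_t x) / E (coord_t x).
Proof.
have sE : smooth1 E by exact: speed2_smooth.
rewrite sum_idx; congr (_ + _ + _).
- rewrite (eq_bigr (fun=> 2 * (derive1 f (coord_t x) / f (coord_t x)))).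
    by rewrite sumr_const card_ord -[_ *+ k]mulr_natl.
  move=> i _; rewrite /metric_coef by_blockE partial_sep_t => [|t]; last first.
    by have [] := dsq t sf.
  rewrite /sep (derive1_val (dsq _ sf)).
  have := gt_eqF (rho_gt0 (coord_y x)); have := gt_eqF (f_gt0 (coord_t x)).
  move: (rho _) (f _) (derive1 _ _) => r p q /negbT p0 /negbT r0.
  by field; rewrite p0 r0.
- rewrite (eq_bigr (fun=> 2 * (derive1 f2 (coord_t x) / f2 (coord_t x)))).
    by rewrite sumr_const card_ord -[_ *+ l]mulr_natl.
  move=> i _; rewrite /metric_coef by_blockE partial_sep_t => [|t]; last first.
    by have [] := dsq t sf2.
  rewrite /sep (derive1_val (dsq _ sf2)).
  have := gt_eqF (rho_gt0 (coord_z x)); have := gt_eqF (f2_gt0 (coord_t x)).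
  move: (rho _) (f2 _) (derive1 _ _) => r p q /negbT p0 /negbT r0.
  by field; rewrite p0 r0.
- rewrite /metric_coef by_blockE partial_sep_t; last exact: (sE 0%N).
  by rewrite /sep !mul1r.
Qed.

(** The hypersurface is a doubly warped product over the profile curve. *)
Lemma laplacian_chart P Q G x : smooth P -> smooth Q -> smooth1 G ->
  laplacian X (sep P Q G) x =
  (f (coord_t x)) ^- 2 * sep (conformal_laplacian P) Q G x
  + (f2 (coord_t x)) ^- 2 * sep P (conformal_laplacian Q) G x
  + sep P Q (profile_laplacian k l f f2 f1 G) x.
Proof.
move=> sP sQ sG.
have dP p : smooth p -> forall i (v : 'rV[R]_k), derivable p v (delta_mx 0 i).
  by move=> sp i v; apply: diff_derivable; exact: smooth_diff.
have dQ p : smooth p -> forall i (v : 'rV[R]_l), derivable p v (delta_mx 0 i).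
  by move=> sp i v; apply: diff_derivable; exact: smooth_diff.
rewrite (laplacian_diag metric_chart metric_coef_neq0) sum_idx; congr (_ + _ + _).
- transitivity (\sum_i f (coord_t x) ^- 2 * rho (coord_y x) ^- 2 * Q (coord_z x)
    * G (coord_t x) * (partial i (partial i P) (coord_y x) + (k%:R - 2)
      * (partial i (@rho R k) (coord_y x) / rho (coord_y x)) * partial i P (coord_y x)));
    last by rewrite -mulr_sumr /sep /conformal_laplacian; ring.
  apply: eq_bigr => i _; rewrite log_metric_y.
  rewrite (partial_sep_y Q G (dP _ sP i)).
  rewrite (partial_sep_y Q G (dP _ (smooth_partial i sP) i)).
  rewrite /metric_coef by_blockE partial_sep_y => [|v]; last exact: ex_derive.
  rewrite /sep (is_derive_partial (drho2 _ _)).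
  have := gt_eqF (rho_gt0 (coord_y x)); have := gt_eqF (f_gt0 (coord_t x)).
  move: (partial i (partial i P) _) (partial i P _) (partial i (@rho R k) _).
  move: (rho _) (f _) (Q _) (G _) => r p q g p2 p1 r1 /negbT p0 /negbT r0.
  by field; rewrite p0 r0.
- transitivity (\sum_i f2 (coord_t x) ^- 2 * rho (coord_z x) ^- 2 * P (coord_y x)
    * G (coord_t x) * (partial i (partial i Q) (coord_z x) + (l%:R - 2)
      * (partial i (@rho R l) (coord_z x) / rho (coord_z x)) * partial i Q (coord_z x)));
    last by rewrite -mulr_sumr /sep /conformal_laplacian; ring.
  apply: eq_bigr => i _; rewrite log_metric_z.
  rewrite (partial_sep_z P G (dQ _ sQ i)).
  rewrite (partial_sep_z P G (dQ _ (smooth_partial i sQ) i)).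
  rewrite /metric_coef by_blockE partial_sep_z => [|v]; last exact: ex_derive.
  rewrite /sep (is_derive_partial (drho2 _ _)).
  have := gt_eqF (rho_gt0 (coord_z x)); have := gt_eqF (f2_gt0 (coord_t x)).
  move: (partial i (partial i Q) _) (partial i Q _) (partial i (@rho R l) _).
  move: (rho _) (f2 _) (P _) (G _) => r p q g p2 p1 r1 /negbT p0 /negbT r0.
  by field; rewrite p0 r0.
- rewrite log_metric_t (partial_sep_t P Q (dg sG)).
  rewrite (partial_sep_t P Q (dg (smooth1_derive1 sG))).
  have sE : smooth1 E by exact: speed2_smooth.
  rewrite /metric_coef by_blockE (partial_sep_t _ _ (dg sE)) /sep /profile_laplacian.
  have := gt_eqF (speed2_gt0 (coord_t x)); rewrite -/E.
  have := gt_eqF (f_gt0 (coord_t x)); have := gt_eqF (f2_gt0 (coord_t x)).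
  abstract_derivatives; move: (E _) (P _) (Q _) (f _) (f2 _).
  move=> e p q y z /negbT z0 /negbT y0 /negbT e0.
  by field; rewrite ?z0 ?y0 ?e0.
Qed.

(** For eigenfunctions P and Q of the two spheres, J u = - n u reduces to an
    ordinary differential equation for the third factor. *)
Lemma stability_chart P Q G (p q : R) x : smooth P -> smooth Q -> smooth1 G ->
  (forall v, conformal_laplacian P v = - p * P v) ->
  (forall w, conformal_laplacian Q w = - q * Q w) ->
  (forall t, profile_laplacian k l f f2 f1 G t - (p / f t ^+ 2 + q / f2 t ^+ 2) * G t
     = - sq_curv k l f f2 f1 t * G t) ->
  stability X (sep P Q G) x = - (k + l + 1)%:R * sep P Q G x.
Proof.
move=> sP sQ sG eP eQ eG.
rewrite /stability (laplacian_chart x sP sQ sG) sqnormA_chart /sep eP eQ.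
have {}eG := eG (coord_t x); move/eqP: eG; rewrite subr_eq => /eqP ->.
by ring.
Qed.

End Chart.

(** * Functions on a product of spheres and a circle *)

Lemma repr_periodic (R : realType) (T : R) (p : R -> R) (t : R) :
  T != 0 -> (forall t, p (t + T) = p t) ->
  p (repr (\pi_({eq_quot (circle_equiv T)}) t)%qT) = p t.
Proof.
move=> T0 pT; set s := repr _.
have : (s == t %[mod {eq_quot (circle_equiv T)}])%qT by rewrite reprK.
rewrite eqmodE => /intrP[m hm].
have -> : s = t + m%:~R * T by rewrite -hm divfK // addrC subrK.
exact: periodic_int.
Qed.

Lemma dotv_eq0 (R : realType) (n : nat) (v : 'rV[R]_n) : dotv v v = 0 -> v = 0.
Proof.
move=> /eqP; rewrite psumr_eq0 => [/allP h|i _]; last by rewrite -expr2 sqr_ge0.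
apply/rowP => i; rewrite mxE; apply/eqP.
by have := h i (mem_index_enum i); rewrite /= mulf_eq0 orbb.
Qed.

Lemma row_free_row_neq0 (F : fieldType) (m n : nat) (A : 'M[F]_(m, n)) i :
  row_free A -> row i A != 0.
Proof.
move=> /row_freeP[B AB]; apply/eqP => A0.
have : row i (1%:M : 'M[F]_m) 0 i = 0 by rewrite -AB row_mul A0 mul0mx mxE.
by rewrite !mxE eqxx => /eqP; rewrite oner_eq0.
Qed.

Lemma multiplicity_finType (R : realType) (k l N : nat) (T : R)
    (Phi : prodM k l T -> 'rV[R]_N) (lambda : R) (I : finType)
    (u : I -> prodM k l T -> R) :
  (forall i, eigenspace_J Phi lambda (u i)) ->
  (forall c : I -> R, (forall p, \sum_i c i * u i p = 0) -> forall i, c i = 0) ->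
  multiplicity_J_ge Phi lambda #|I|.
Proof.
move=> hu hind; exists (fun i => u (enum_val i)); split=> [i|c hc i]; first exact: hu.
rewrite -[i]enum_valK.
apply: (hind (fun x => c (enum_rank x))) => p; rewrite -[RHS](hc p).
rewrite (reindex _ (onW_bij _ (@enum_val_bij I))) /=.
by apply: eq_bigr => j _; rewrite enum_valK.
Qed.

(** * The coordinates of a sphere, together with the constant 1 *)

Section Ocoord.
Context {R : realType} {k : nat}.

Definition ocoord (a : option 'I_(1 + k)) (y : 'rV[R]_(1 + k)) : R :=
  if a is Some i then y 0 i else 1.

Definition oeigen (a : option 'I_(1 + k)) : R := if a then k%:R else 0.

Let ocoord_height i b : (fun v => ocoord (Some i) (stereo_vec b v)) =
  height ((-1) ^+ b * (lsubmx (delta_mx 0 i : 'rV[R]_(1 + k))) 0 0)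
         (rsubmx (delta_mx 0 i : 'rV[R]_(1 + k))).
Proof. by apply/funext => v; rewrite /ocoord stereo_vec_height. Qed.

Lemma smooth_ocoord a b : smooth (fun v => ocoord a (stereo_vec b v)).
Proof.
by case: a => [i|]; [rewrite ocoord_height; exact: smooth_height | exact: smooth_cst].
Qed.

Lemma conformal_laplacian_ocoord a b v :
  conformal_laplacian (fun v => ocoord a (stereo_vec b v)) v =
  - oeigen a * ocoord a (stereo_vec b v).
Proof.
case: a => [i|]; last by rewrite conformal_laplacian_cst oppr0 mul0r.
rewrite ocoord_height conformal_laplacian_height -ocoord_height.
by rewrite /ocoord stereo_vec_height.
Qed.

(** For [None] the even part at opposite points of any axis will do; the first
    one is used. *)
Definition opt_point (a : option 'I_(1 + k)) (s : bool) : 'rV[R]_(1 + k) :=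
  (-1) ^+ s *: delta_mx 0 (odflt (lshift k ord0) a).

Lemma opt_point_sphere a s : dotv (opt_point a s) (opt_point a s) == 1.
Proof. by rewrite dotvZ sqrr_sign mul1r dotv_delta mxE !eqxx. Qed.

Definition opt_sign (a : option 'I_(1 + k)) (s : bool) : R :=
  if a then (-1) ^+ s else 1.

(** The even part at two opposite points of an axis kills every coordinate; the
    odd part kills the constant and the coordinates along the other axes. *)
Lemma ocoord_dual a c :
  \sum_(s : bool) opt_sign a s * ocoord c (opt_point a s) = 2 * (c == a)%:R.
Proof.
rewrite big_bool /opt_sign /ocoord /opt_point.
case: a => [i|]; case: c => [j|] /=; rewrite ?mxE ?eqxx /= ?expr1 ?expr0.
- rewrite (_ : (Some j == Some i) = (j == i)) //; ring.
- by ring.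
- by ring.
- by rewrite ?eqxx; ring.
Qed.

End Ocoord.

(** * The eigenfunctions *)

Section Main.
Context {R : realType} {k l : nat} {T : R} {f f2 f1 : R -> R}.
Hypotheses (sf : smooth1 f) (sf2 : smooth1 f2) (sf1 : smooth1 f1).
Hypotheses (f_gt0 : forall t, 0 < f t) (f2_gt0 : forall t, 0 < f2 t).
Hypothesis unit_curve : forall t, f t ^+ 2 + f2 t ^+ 2 + f1 t ^+ 2 = 1.
Hypothesis T_gt0 : 0 < T.
Hypotheses (fT : forall t, f (t + T) = f t) (f2T : forall t, f2 (t + T) = f2 t).
Hypothesis f1T : forall t, f1 (t + T) = f1 t.

Let Phi := @phi R k l T f f2 f1.

(** The choice of a representative of the angle disappears by periodicity. *)
Lemma phi_chart b : Phi \o chart T b = hyp_chart f f2 f1 b.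
Proof.
apply/funext => x; rewrite /Phi /phi /= /hyp_chart /vsep.
have T0 : T != 0 by rewrite gt_eqF.
rewrite (repr_periodic _ T0 fT) (repr_periodic _ T0 f2T) (repr_periodic _ T0 f1T).
by [].
Qed.

(** The last row of the Jacobian matrix, whose squared length is the last
    diagonal coefficient of the metric, is not zero. *)
Lemma immersion_speed2 : immersion Phi -> forall t, 0 < speed2 f f2 f1 t.
Proof.
move=> [_ _ imm] t; pose x : 'rV[R]_(k + l + 1) := row_mx 0 t%:M.
have xt : coord_t x = t by rewrite /coord_t row_mxKr mxE mulr1n.
have := row_free_row_neq0 idx_t (imm (false, false) x).
rewrite phi_chart rowK; set v := partial _ _ _ => v0.
have <- : dotv v v = speed2 f f2 f1 t.
  have := metric_chart sf sf2 sf1 (false, false) x.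
  move/matrixP/(_ idx_t idx_t); rewrite !mxE eqxx mulr1n /metric_coef by_blockE.
  by rewrite /sep !mul1r xt.
by rewrite lt_neqAle dotv_ge0 andbT eq_sym; apply: contra_neq v0; exact: dotv_eq0.
Qed.

Hypothesis speed2_gt0 : forall t, 0 < speed2 f f2 f1 t.
Hypothesis minimal_curve : forall t,
  derive1 (derive1 f) t * nu_y f f2 f1 t + derive1 (derive1 f2) t * nu_z f f2 f1 t
  + derive1 (derive1 f1) t * nu_t f f2 f1 t = curv k l f f2 f1 t * speed2 f f2 f1 t.

(** The profile of the eigenfunction with a coordinate of the first sphere as a
    factor if [sy], and one of the second sphere if [sz]. *)
Definition profile (sy sz : bool) : R -> R :=
  match sy, sz with
  | false, false => nu_t f f2 f1
  | true, false => nu_y f f2 f1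
  | false, true => nu_z f f2 f1
  | true, true => inv_vol k l f f2
  end.

Lemma smooth_profile sy sz : smooth1 (profile sy sz).
Proof.
by case: sy; case: sz; [exact: inv_vol_smooth | exact: nu_comp_smooth
  | exact: nu_comp_smooth | exact: nu_comp_smooth].
Qed.

Lemma profile_periodic sy sz t : profile sy sz (t + T) = profile sy sz t.
Proof.
have nuT p q : (forall t, p (t + T) = p t) -> (forall t, q (t + T) = q t) ->
    nu_comp f f2 f1 p q (t + T) = nu_comp f f2 f1 p q t.
  move=> pT qT; rewrite /nu_comp /speed2 pT qT.
  by rewrite !(derive1_periodic pT, derive1_periodic qT, derive1_periodic fT,
               derive1_periodic f2T, derive1_periodic f1T).
case: sy; case: sz => /=; [by rewrite /inv_vol fT f2T | exact: nuT | exact: nuT | exact: nuT].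
Qed.

Lemma profile_neq0 sy sz : exists t, profile sy sz t != 0.
Proof.
case: sy; case: sz => /=.
- by exists 0; rewrite gt_eqF // inv_vol_gt0.
- have [t ht] := periodic_critical_point T_gt0 sf fT.
  by exists t; exact: nu_y_neq0.
- have [t ht] := periodic_critical_point T_gt0 sf2 f2T.
  by exists t; exact: nu_z_neq0.
- have [t ht] := periodic_critical_point T_gt0 sf1 f1T.
  by exists t; exact: nu_t_neq0.
Qed.

Lemma profile_ode (a : option 'I_(1 + k)) (c : option 'I_(1 + l)) t :
  profile_laplacian k l f f2 f1 (profile a c) t
  - (oeigen a / f t ^+ 2 + oeigen c / f2 t ^+ 2) * profile a c t
  = - sq_curv k l f f2 f1 t * profile a c t.
Proof.
case: a => [i|]; case: c => [j|] /=.
- exact: profile_laplacian_inv_vol.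
- by rewrite mul0r addr0; exact: profile_laplacian_nu_y.
- by rewrite mul0r add0r; exact: profile_laplacian_nu_z.
- by rewrite !mul0r addr0 mul0r subr0; exact: profile_laplacian_nu_t.
Qed.

Definition eigenfun (i : option 'I_(1 + k) * option 'I_(1 + l)) (p : prodM k l T) : R :=
  ocoord i.1 (val p.1.1) * ocoord i.2 (val p.1.2) * profile i.1 i.2 (repr p.2).

Lemma eigenfun_chart i b : eigenfun i \o chart T b =
  sep (fun v => ocoord i.1 (stereo_vec b.1 v)) (fun w => ocoord i.2 (stereo_vec b.2 w))
      (profile i.1 i.2).
Proof.
apply/funext => x; rewrite /eigenfun /sep /=; congr (_ * _).
by apply: repr_periodic; [rewrite gt_eqF | exact: profile_periodic].
Qed.

Lemma eigenfun_eigenspace i : eigenspace_J Phi (- (k + l + 1)%:R) (eigenfun i).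
Proof.
split=> [b|b x].
  rewrite eigenfun_chart.
  by apply: smooth_sep; [exact: smooth_ocoord | exact: smooth_ocoord | exact: smooth_profile].
rewrite -[eigenfun i (chart T b x)]/((eigenfun i \o chart T b) x) eigenfun_chart phi_chart.
exact: (stability_chart sf sf2 sf1 f_gt0 f2_gt0 unit_curve b speed2_gt0 minimal_curve x
  (@smooth_ocoord _ _ i.1 b.1) (@smooth_ocoord _ _ i.2 b.2) (@smooth_profile i.1 i.2)
  (conformal_laplacian_ocoord i.1 b.1) (conformal_laplacian_ocoord i.2 b.2)
  (profile_ode i.1 i.2)).
Qed.

(** The signed sum over the four points given by the signs of the two chosen
    axes is four times the coefficient times the profile. *)
Lemma eigenfun_free (c : option 'I_(1 + k) * option 'I_(1 + l) -> R) :
  (forall p, \sum_i c i * eigenfun i p = 0) -> forall i, c i = 0.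
Proof.
move=> hc [a d]; have [t Gt] := profile_neq0 a d.
pose P s s' : prodM k l T :=
  (exist _ (opt_point a s) (opt_point_sphere a s),
   exist _ (opt_point d s') (opt_point_sphere d s'),
   \pi_({eq_quot (circle_equiv T)})%qT t).
have uP i s s' : eigenfun i (P s s') =
    ocoord i.1 (opt_point a s) * ocoord i.2 (opt_point d s') * profile i.1 i.2 t.
  rewrite /eigenfun /=; congr (_ * _).
  by apply: repr_periodic; [rewrite gt_eqF | exact: profile_periodic].
have : \sum_(s : bool) \sum_(s' : bool) opt_sign a s * opt_sign d s' *
    (\sum_i c i * eigenfun i (P s s')) = 0.
  by apply: big1 => s _; apply: big1 => s' _; rewrite hc mulr0.
have -> : \sum_(s : bool) \sum_(s' : bool) opt_sign a s * opt_sign d s' *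
    (\sum_i c i * eigenfun i (P s s')) =
    \sum_i c i * profile i.1 i.2 t * (2 * (i.1 == a)%:R) * (2 * (i.2 == d)%:R).
  under eq_bigr => s _ do under eq_bigr => s' _ do rewrite mulr_sumr.
  under eq_bigr => s _ do rewrite exchange_big /=.
  rewrite exchange_big /=; apply: eq_bigr => i _.
  rewrite -!ocoord_dual -mulrA big_distrlr /= mulr_sumr.
  apply: eq_bigr => s _; rewrite mulr_sumr; apply: eq_bigr => s' _.
  by rewrite uP; ring.
rewrite (bigD1 (a, d)) //= !eqxx big1 => [|[a' d'] /=]; last first.
  rewrite xpair_eqE negb_and => /orP[] /negPf ->; first by rewrite mulr0 mulr0 mul0r.
  by rewrite mulr0 mulr0.
rewrite addr0 mulr1 => /eqP; rewrite !mulf_eq0 pnatr_eq0 (negPf Gt) /= !orbF.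
by move/eqP.
Qed.

Lemma stability_spectrum :
  is_eigenvalue_J Phi (- (k + l + 1)%:R) /\
  multiplicity_J_ge Phi (- (k + l + 1)%:R) ((k + l + 3) + (k + 1) * (l + 1)).
Proof.
split.
  pose o (n : nat) : option 'I_(1 + n) := Some (lshift n ord0).
  exists (eigenfun (o k, o l)); split; first exact: eigenfun_eigenspace.
  exists (exist _ (opt_point (o k) false) (opt_point_sphere _ _),
    exist _ (opt_point (o l) false) (opt_point_sphere _ _),
    \pi_({eq_quot (circle_equiv T)})%qT 0).
  rewrite /eigenfun /= !mxE !eqxx expr0 !mulr1 mul1r gt_eqF //.
  exact: inv_vol_gt0.
have -> : ((k + l + 3) + (k + 1) * (l + 1))%N =
    #|{: option 'I_(1 + k) * option 'I_(1 + l)}|.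
  by rewrite card_prod !card_option !card_ord; ring.
exact: (multiplicity_finType eigenfun_eigenspace eigenfun_free).
Qed.

End Main.

Theorem mainTheorem3 (R : realType) (k l : nat) (T : R) (f1 f2 : R -> R)
    (k_ge1 : (1 <= k)%N) (l_ge1 : (1 <= l)%N) (T_gt0 : 0 < T)
    (f1_smooth : smooth1 f1) (f2_smooth : smooth1 f2)
    (f1_periodic : forall t : R, f1 (t + T) = f1 t)
    (f2_periodic : forall t : R, f2 (t + T) = f2 t)
    (f2_gt0 : forall t : R, 0 < f2 t)
    (f12_lt1 : forall t : R, f1 t ^+ 2 + f2 t ^+ 2 < 1) :
  let f := fun t : R => Num.sqrt (1 - f1 t ^+ 2 - f2 t ^+ 2) in
  let Phi := @phi R k l T f f2 f1 in
  immersion Phi -> minimal Phi ->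
  is_eigenvalue_J Phi (- (k + l + 1)%:R) /\
  multiplicity_J_ge Phi (- (k + l + 1)%:R)
    ((k + l + 3) + (k + 1) * (l + 1)).
Proof.
move=> f Phi imm mini.
have f2_lt1 t : 0 < 1 - f1 t ^+ 2 - f2 t ^+ 2 by have := f12_lt1 t; lra.
have f_gt0 t : 0 < f t by rewrite sqrtr_gt0.
have f_smooth : smooth1 f.
  apply: smooth1_sqrt f2_lt1; apply: smooth1_alg.
  apply: gen_sub; last exact/gen_exp/gen_base.
  by apply: gen_sub; [exact: gen_cst | exact/gen_exp/gen_base].
have f_periodic t : f (t + T) = f t by rewrite /f f1_periodic f2_periodic.
have unit_curve t : f t ^+ 2 + f2 t ^+ 2 + f1 t ^+ 2 = 1.
  by rewrite /f sqr_sqrtr ?ltW //; ring.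
have sp := immersion_speed2 f_smooth f2_smooth f1_smooth T_gt0 f_periodic f2_periodic
  f1_periodic imm.
have mc x : mean_curvature (@hyp_chart R k l f f2 f1 (false, false)) x = 0.
  by rewrite -(phi_chart T_gt0 f_periodic f2_periodic f1_periodic); exact: mini.
have curvE := minimal_chart f_smooth f2_smooth f1_smooth f_gt0 f2_gt0 unit_curve sp mc.
exact: (stability_spectrum f_smooth f2_smooth f1_smooth f_gt0 f2_gt0 unit_curve T_gt0
  f_periodic f2_periodic f1_periodic sp curvE).
Qed.
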